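(* Let $\mathbf{A}(x)\in\mathrm{M}_{L\times N}(\mathbb{Z}[x])$, written $\mathbf{A}(x)=A_0+xA_1+\cdots+x^DA_D$ with $A_0,\dots,A_D\in\mathrm{M}_{L\times N}(\mathbb{Z})$, and let $\mathbf{A}_{\ast}(x)=\mathbf{A}(x)-A_0$. The following are equivalent: (1) For any infinite subset $X\subset\mathbb{T}^N$ there exists a subtorus $\mathcal{T}=\mathcal{T}(X,\mathbf{A})$ of $\mathbb{T}^L$ such that for any $\epsilon>0$ there exists an integer $n$ such that $\mathbf{A}(n)X=\{\mathbf{A}(n)\mathbf{x}:\mathbf{x}\in X\}$ is $\epsilon$-dense in a translate of $\mathcal{T}$. (2) (a) The columns of $\mathbf{A}_{\ast}(x)$ are $\mathbb{Q}$-linearly independent, and (b) whenever $\mathbf{v}\in\mathbb{Q}^L$ and $\mathbf{w}\in\mathbb{Q}^N$ satisfy $\mathbf{v}\cdot A_d\mathbf{w}=0$ for each $d=1,\dots,D$, then also $\mathbf{v}\cdot A_0\mathbf{w}=0$.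
   Context: $\mathbb{T}=\mathbb{R}/\mathbb{Z}$; points of $\mathbb{T}^m$ are identified with their representatives in $[0,1)^m$, and an integer matrix acts on tori by left multiplication. A subtorus of $\mathbb{T}^L$ is a non-trivial closed connected Lie subgroup. For $\mathbf{x}\in\mathbb{R}^L$, $\|\mathbf{x}\|$ denotes the sup-norm distance from $\mathbf{x}$ to $\mathbb{Z}^L$. A set $Y\subset\mathbb{T}^L$ is $\epsilon$-dense in a subset $S\subset\mathbb{T}^L$ (e.g. a translate of a subtorus) if for every $\mathbf{s}\in S$ there is $\mathbf{y}\in Y\cap S$ with $\|\mathbf{y}-\mathbf{s}\|\le\epsilon$; for $S=\mathbb{T}^L$ this means $Y$ meets every box of side length $2\epsilon$. The columns of $\mathbf{A}_\ast(x)$ are regarded as vectors in $\mathbb{Q}[x]^L$. *)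

(* Defs.v *)
From HB Require Import structures.
From mathcomp Require Import all_boot all_order all_algebra.
From mathcomp Require Import all_classical all_reals all_analysis.
Import Order.TTheory GRing.Theory Num.Theory.
Import numFieldNormedType.Exports.

Set Implicit Arguments.
Unset Strict Implicit.
Unset Printing Implicit Defensive.

Local Open Scope classical_set_scope.
Local Open Scope ring_scope.
Local Open Scope quotient_scope.

Section Torus.
Variables (R : realType) (m : nat).

Definition intvec : {pred 'cV[R]_m} := mxOver_pred (@Num.int R).

Lemma intvec_zmod_closed : zmod_closed intvec.
Proof.
split=> [|x y /mxOverP xZ /mxOverP yZ].
  by apply/mxOverP => i j; rewrite mxE rpred0.
by apply/mxOverP => i j; rewrite !mxE rpredB.
Qed.

HB.instance Definition _ :=
  GRing.isZmodClosed.Build 'cV[R]_m intvec intvec_zmod_closed.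

(* T^m = R^m / Z^m: the group structure comes from the algebraic quotient and  *)
(* the topology is the quotient topology.                                      *)
Definition torus : Type := quotient_topology (Quotient.quot intvec).

HB.instance Definition _ := Topological.on torus.
HB.instance Definition _ := Quotient.on torus.
HB.instance Definition _ := GRing.isZmodule.Build torus
  (@Quotient.addqA _ intvec) (@Quotient.addqC _ intvec)
  (@Quotient.add0q _ intvec) (@Quotient.addNq _ intvec).

Lemma pi_torus_is_zmod_morphism : zmod_morphism (\pi_torus).
Proof.
move=> x y.
exact: (@raddfB _ _ (\pi_(Quotient.quot intvec) : {additive _ -> _})).
Qed.

HB.instance Definition _ :=
  GRing.isZmodMorphism.Build 'cV[R]_m torus \pi_torus pi_torus_is_zmod_morphism.

Lemma pi_torus_eq (x y : 'cV[R]_m) :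
  \pi_torus x = \pi_torus y <-> x - y \is a mxOver Num.int.
Proof.
rewrite -[x - y \is a _]/(x - y \in intvec) (Quotient.idealrBE intvec).
by split=> [xy|/eqP xy]; [apply/eqP|]; exact: xy.
Qed.

(* The sup-norm distance from x to Z^m; `|_| is the sup norm on 'cV[R]_m.       *)
Definition distZ (x : 'cV[R]_m) : R :=
  inf [set `|x - z| | z in [set z : 'cV[R]_m | z \is a mxOver Num.int]].

Lemma distZ_periodic (x z : 'cV[R]_m) :
  z \is a mxOver Num.int -> distZ (x + z) = distZ x.
Proof.
move=> zZ; congr inf; apply/seteqP; split=> _ [w wZ <-] /=.
  exists (w - z); last by rewrite opprB addrA addrAC.
  by apply/mxOverP => i j; rewrite !mxE rpredB//; [move/mxOverP: wZ|move/mxOverP: zZ].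
exists (w + z); last by rewrite opprD addrACA subrr addr0.
by apply/mxOverP => i j; rewrite !mxE rpredD//; [move/mxOverP: wZ|move/mxOverP: zZ].
Qed.

(* By distZ_periodic, this does not depend on the representative.              *)
Definition torus_norm (x : torus) : R := distZ (repr x).

Lemma torus_norm_pi (x : 'cV[R]_m) : torus_norm (\pi_torus x) = distZ x.
Proof.
have /pi_torus_eq xZ : \pi_torus (repr (\pi_torus x)) = \pi_torus x.
  by rewrite reprK.
by rewrite /torus_norm -[in RHS](distZ_periodic x xZ) addrC subrK.
Qed.

(* A closed subgroup of a Lie group is automatically a Lie subgroup, so        *)
(* closed connected Lie subgroups are the closed connected subgroups.          *)
Definition subtorus (S : set torus) : Prop :=
  [/\ S 0 /\ (forall x y, S x -> S y -> S (x - y)),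
      closed S, connected S & S <> [set 0]].

Definition eps_dense (e : R) (Y S : set torus) : Prop :=
  forall s, S s -> exists2 y, (Y `&` S) y & torus_norm (y - s) <= e.

Definition translate (a : torus) (S : set torus) : set torus :=
  [set a + s | s in S].

End Torus.

Section Action.
Variables (R : realType) (m n : nat).

Definition torus_act (M : 'M[int]_(m, n)) (x : torus R n) : torus R m :=
  \pi_(torus R m) (map_mx intr M *m repr x).

Lemma torus_act_pi (M : 'M[int]_(m, n)) (x : 'cV[R]_n) :
  torus_act M (\pi_(torus R n) x) = \pi_(torus R m) (map_mx intr M *m x).
Proof.
apply/pi_torus_eq; rewrite -mulmxBr.
have /pi_torus_eq/mxOverP xZ :
  \pi_(torus R n) (repr (\pi_(torus R n) x)) = \pi_(torus R n) x by rewrite reprK.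
apply/mxOverP => i j; rewrite mxE rpred_sum// => k _.
by rewrite rpredM// mxE intr_int.
Qed.

End Action.

Section PolyMatrix.
Variables (L N : nat).

Definition eval_mx (A : 'M[{poly int}]_(L, N)) (n : int) : 'M[int]_(L, N) :=
  map_mx (fun p => p.[n]) A.

(* Q-linear independence of the family of columns of B, in the Q-vector space  *)
(* Q[x]^L (infinite-dimensional, hence outside the scope of free).             *)
Definition cols_Q_free (B : 'M[{poly rat}]_(L, N)) : Prop :=
  forall c : 'I_N -> rat,
    \sum_(j < N) (c j)%:P *: col j B = 0 -> forall j, c j = 0.

Definition dotv (u v : 'cV[rat]_L) : rat := \sum_(i < L) u i 0 * v i 0.

End PolyMatrix.

(* Main.v *)
(* (2) => (1).  Induction on N.  If infinitely many points of X lie in one coset of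
   a proper closed subgroup, i.e. if m.x takes some value mod 1 infinitely often for
   some nonzero integer row m, then a unimodular change of coordinates turns these
   points into an infinite subset of a coset of T^(N-1), and restricting A(n) to this
   subtorus preserves (a) and (b).  Otherwise X is "generic": any k, B allow x_1, ..., x_k
   in X with sum_i m_i.x_i never an integer for integer rows m_i, not all zero, of
   entries at most B.  By (b) a unimodular change of coordinates of Z^L reduces all A(n)
   to the same set I of rows, on which A_1, ..., A_D have no common left kernel; T is
   the corresponding coordinate subtorus.  Every nontrivial character of T^k then
   evaluates at (A(n) x_i)_i to a polynomial in n with a nonconstant coefficient that is
   irrational or has a large denominator, so its averages are small by Weyl
   differencing; testing with a product of Fejer kernels gives an n for which the
   A(n) x_i are simultaneously close to a prescribed fine grid of T.

   (1) => (2).  If A_d w = 0 (resp. v A_d w = 0) for all d > 0, then A(n) w (resp. v A(n) w)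
   does not depend on n.  Take for X a sequence of small multiples of w.  As T is
   approximated by differences of points of A(n) X, the torus T (resp. v T) has only
   small elements, hence is trivial.  In the second case A(n) X meets each
   translate of T in at most one point when v A_0 w <> 0, and T is trivial again. *)
Require Import Defs.
From mathcomp Require Import all_boot all_order all_algebra.
From mathcomp Require Import all_classical all_reals all_analysis.
From mathcomp Require Import ring lra zify.
Import Order.TTheory GRing.Theory Num.Theory.
Import numFieldNormedType.Exports.

Local Open Scope classical_set_scope.
Local Open Scope ring_scope.

Set Implicit Arguments.
Unset Strict Implicit.
Unset Printing Implicit Defensive.

(** * Averages and trigonometric sums *)

Section Averages.
Variable R : realType.
Implicit Types (u v : nat -> R) (e : R).

(** A limit-free bound on the limsup of the averages of [u]. Since the bound is exact from [M0] on,
    a strict gap between two constants is what absorbs bounded error terms. *)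
Definition avg_le u e :=
  exists M0 : nat, forall M, (M0 <= M)%N -> `|\sum_(n < M) u n| <= e * M%:R.

Lemma avg_leD u v e1 e2 :
  avg_le u e1 -> avg_le v e2 -> avg_le (fun n => u n + v n) (e1 + e2).
Proof.
move=> [M1 h1] [M2 h2]; exists (maxn M1 M2) => M.
rewrite geq_max => /andP[/h1 le1 /h2 le2].
rewrite big_split /= mulrDl; apply: le_trans (ler_normD _ _) _.
exact: lerD.
Qed.

Lemma avg_leM c u e : avg_le u e -> avg_le (fun n => c * u n) (`|c| * e).
Proof.
move=> [M1 h1]; exists M1 => M /h1 le1.
by rewrite -mulr_sumr normrM -mulrA ler_wpM2l.
Qed.

Lemma avg_leW u e1 e2 : e1 <= e2 -> avg_le u e1 -> avg_le u e2.
Proof.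
move=> le12 [M1 h1]; exists M1 => M /h1 le1.
by apply: le_trans le1 _; rewrite ler_wpM2r.
Qed.

Lemma avg_le0 : avg_le (fun=> 0) 0.
Proof. by exists 0%N => M _; rewrite big1// normr0 mul0r. Qed.

Lemma avg_le_sum (I : Type) (r : seq I) (P : pred I) (u : I -> nat -> R)
    (e : I -> R) :
  (forall i, P i -> avg_le (u i) (e i)) ->
  avg_le (fun n => \sum_(i <- r | P i) u i n) (\sum_(i <- r | P i) e i).
Proof.
move=> ue; elim: r => [|i r IH].
  rewrite (_ : (fun n => _) = fun=> 0); last by apply/funext=> n; rewrite big_nil.
  by rewrite big_nil; exact: avg_le0.
rewrite (_ : (fun n => _) = fun n => (if P i then u i n else 0) +
    \sum_(j <- r | P j) u j n); last first.
  by apply/funext=> n; rewrite big_cons; case: ifP => //; rewrite add0r.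
rewrite big_cons; case: ifP => Pi; first exact: avg_leD (ue _ Pi) IH.
by rewrite -[X in avg_le _ X]add0r; apply: avg_leD IH; exact: avg_le0.
Qed.

Lemma sum_shift u M h :
  \sum_(n < M) u (n + h)%N =
  \sum_(n < M) u n + \sum_(n < h) u (M + n)%N - \sum_(n < h) u n.
Proof.
elim: M => [|M IH].
  by rewrite !big_ord0 add0r; under [X in X - _]eq_bigr do rewrite add0n; rewrite subrr.
rewrite !big_ord_recr /= IH; have E : \sum_(n < h.+1) u (M + n)%N = \sum_(n < h) u (M + n)%N + u (M + h)%N.
  by rewrite big_ord_recr.
rewrite big_ord_recl /= addn0 in E.
have {E} -> : \sum_(i < h) u (M.+1 + i)%N =
    \sum_(i < h) u (M + i)%N + u (M + h)%N - u M.
  rewrite -E addrC addKr; apply: eq_bigr => i _.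
  by rewrite /bump /= addSnnS.
ring.
Qed.

Lemma norm_sum_le u M : (forall n, `|u n| <= 1) -> `|\sum_(n < M) u n| <= M%:R.
Proof.
move=> u1; apply: le_trans (ler_norm_sum _ _ _) _.
by rewrite -[X in _ <= X%:R]card_ord -sum1_card natr_sum ler_sum.
Qed.

Lemma sum_shift_le u M h : (forall n, `|u n| <= 1) ->
  `|\sum_(n < M) u (n + h)%N - \sum_(n < M) u n| <= 2 * h%:R.
Proof.
move=> u1; rewrite sum_shift [X in `|X|](_ : _ = \sum_(n < h) u (M + n)%N -
  \sum_(n < h) u n); last ring.
apply: le_trans (ler_normB _ _) _.
have := @norm_sum_le (fun n => u (M + n)%N) h (fun n => u1 _).
have := norm_sum_le h u1; lra.
Qed.

Lemma avg_le_shift u e1 e2 h : (forall n, `|u n| <= 1) -> e1 < e2 ->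
  avg_le u e1 -> avg_le (fun n => u (n + h)%N) e2.
Proof.
move=> u1 e12 [M1 h1].
exists (maxn M1 (Num.truncn (2 * h%:R / (e2 - e1))).+1) => M.
rewrite geq_max => /andP[/h1 le1 leM].
have : 2 * h%:R / (e2 - e1) <= M%:R.
  by apply: ltW; apply: lt_le_trans (truncnS_gt _) _; rewrite ler_nat.
rewrite ler_pdivrMr ?subr_gt0// => leM'.
have := sum_shift_le M h u1.
have := ler_normD (\sum_(n < M) u (n + h)%N - \sum_(n < M) u n) (\sum_(n < M) u n).
rewrite subrK; lra.
Qed.

Lemma avg_le_bounded u e c : 0 < e -> (forall M, `|\sum_(n < M) u n| <= c) ->
  avg_le u e.
Proof.
move=> e0 uc; exists (Num.truncn (c / e)).+1 => M leM.
apply: le_trans (uc M) _; rewrite mulrC -ler_pdivrMr//.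
by apply: ltW; apply: lt_le_trans (truncnS_gt _) _; rewrite ler_nat.
Qed.

Lemma sum_residues u q M :
  \sum_(n < M * q) u n = \sum_(s < q) \sum_(n < M) u (q * n + s)%N.
Proof.
rewrite exchange_big /=; elim: M => [|M IH]; first by rewrite mul0n !big_ord0.
rewrite big_ord_recr -IH /= mulSnr.
rewrite -!(big_mkord xpredT u) (big_cat_nat (n := (M * q)%N)) ?leq_addr//=.
congr (_ + _); rewrite -{1}[(M * q)%N]add0n big_addn addKn big_mkord.
by apply: eq_bigr => i _; rewrite addnC mulnC.
Qed.

(** The range below [M] consists of [M %/ q] full periods, treated one residue class at a time, and
    fewer than [q] leftover terms, which the gap [e2 - e1] absorbs. *)
Lemma avg_le_residues u e1 e2 q : (forall n, `|u n| <= 1) -> (0 < q)%N ->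
  0 <= e1 -> e1 < e2 ->
  (forall s, (s < q)%N -> avg_le (fun n => u (q * n + s)%N) e1) -> avg_le u e2.
Proof.
move=> u1 q0 e10 e12 uq.
have /choice[M0 hM0] : forall s : 'I_q, exists M0, forall M, (M0 <= M)%N ->
  `|\sum_(n < M) u (q * n + s)%N| <= e1 * M%:R by move=> s; exact: uq.
exists (maxn ((\max_s M0 s).+1 * q) (Num.truncn (q%:R / (e2 - e1))).+1) => M.
rewrite geq_max => /andP[leM1 leM2].
have : q%:R / (e2 - e1) <= M%:R.
  by apply: ltW; apply: lt_le_trans (truncnS_gt _) _; rewrite ler_nat.
rewrite ler_pdivrMr ?subr_gt0// => leM'.
have lediv : (\max_s M0 s <= M %/ q)%N by rewrite leq_divRL//; nia.
have mod_lt := ltn_pmod M q0.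
have -> : \sum_(n < M) u n = \sum_(s < q) \sum_(n < M %/ q) u (q * n + s)%N +
    \sum_(n < M %% q) u (n + M %/ q * q)%N.
  rewrite -sum_residues -!(big_mkord xpredT u) [in LHS](divn_eq M q).
  rewrite (big_cat_nat (n := (M %/ q * q)%N)) ?leq_addr//=; congr (_ + _).
  by rewrite -{1}[(M %/ q * q)%N]add0n big_addn addKn big_mkord.
apply: le_trans (ler_normD _ _) _.
have le1 : `|\sum_(n < M %% q) u (n + M %/ q * q)%N| <= q%:R.
  apply: (@le_trans _ _ (M %% q)%:R); last by rewrite ler_nat ltnW.
  exact: (@norm_sum_le (fun n => u (n + M %/ q * q)%N)).
have le2 : `|\sum_(s < q) \sum_(n < M %/ q) u (q * n + s)%N| <= e1 * M%:R.
  apply: le_trans (ler_norm_sum _ _ _) _.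
  apply: (@le_trans _ _ (\sum_(s < q) e1 * (M %/ q)%:R)).
    apply: ler_sum => s _; apply: hM0; apply: leq_trans lediv.
    exact: (@leq_bigmax _ M0).
  rewrite sumr_const card_ord -mulrnAr ler_wpM2l// -mulr_natr -natrM ler_nat.
  exact: leq_trunc_div.
lra.
Qed.

End Averages.

(** * Cosines and sines of period one *)

Section Cosines.
Variable R : realType.
Implicit Types (x y t b : R).

(** [cos1] and [sin1] are the real and imaginary parts of the character exp(2 pi i x); the argument
    stays within the reals. *)
Definition cos1 x : R := cos (2 * pi * x).
Definition sin1 x : R := sin (2 * pi * x).

Lemma cos_sin_period x (n : nat) :
  cos (x + 2 * pi * n%:R) = cos x /\ sin (x + 2 * pi * n%:R) = sin x.
Proof.
have -> : 2 * pi * n%:R = (pi *+ 2) *+ n :> R by rewrite -[RHS]mulr_natr -[pi *+ 2]mulr_natl.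
by rewrite (periodicn (@cosD2pi R)) (periodicn (@sinD2pi R)).
Qed.

Lemma cos1_sin1_eq x y : x - y \is a Num.int -> cos1 x = cos1 y /\ sin1 x = sin1 y.
Proof.
move=> /intrP[z Ez]; have {Ez} -> : x = y + z%:~R by rewrite -Ez addrC subrK.
rewrite /cos1 /sin1; case: z => n.
  by rewrite mulrDr -pmulrn; have [-> ->] := cos_sin_period (2 * pi * y) n.
rewrite NegzE mulrNz -pmulrn.
have [<- <-] := cos_sin_period (2 * pi * (y - n.+1%:R)) n.+1.
by rewrite -mulrDr subrK.
Qed.

Lemma cos1_eq x y : x - y \is a Num.int -> cos1 x = cos1 y.
Proof. by move=> /cos1_sin1_eq[]. Qed.

Lemma cos1N x : cos1 (- x) = cos1 x.
Proof. by rewrite /cos1 mulrN cosN. Qed.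

Lemma cos1B x y : cos1 (x - y) = cos1 x * cos1 y + sin1 x * sin1 y.
Proof. by rewrite /cos1 /sin1 mulrBr cosB. Qed.

Lemma cos1_le1 x : `|cos1 x| <= 1.
Proof. exact: cos_max. Qed.

Lemma sin1_le1 x : `|sin1 x| <= 1.
Proof. exact: sin_max. Qed.

Lemma sin1E x : sin1 x = cos1 (x - 4^-1).
Proof.
rewrite /sin1 /cos1 mulrBr -cosBpihalf; congr cos; congr (_ - _).
by rewrite mulrAC mulrC; congr (_ * _); field.
Qed.

Lemma sin_pi_sqr x : sin (pi * x) ^+ 2 = (1 - cos1 x) / 2.
Proof.
rewrite /cos1 (_ : 2 * pi * x = (pi * x) *+ 2); last by rewrite -[RHS]mulr_natl mulrA.
by rewrite cos_mulr2n cos2sin2; field.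
Qed.

Lemma sin_pi_int x : x \is a Num.int -> sin (pi * x) = 0.
Proof.
move=> xZ; apply/eqP; rewrite -sqrf_eq0 sin_pi_sqr (@cos1_eq x 0) ?subr0//.
by rewrite /cos1 mulr0 cos0 subrr mul0r.
Qed.

(** Multiplied by 2 sin(pi t), each term becomes a difference of sines at half steps, and the sum
    telescopes. The product form avoids dividing by a possibly zero sine. *)
Lemma sum_cos1_le b t M : `|sin (pi * t)| * `|\sum_(n < M) cos1 (b + n%:R * t)| <= 1.
Proof.
pose S n := sin1 (b + n%:R * t - t / 2).
have E : 2 * sin (pi * t) * (\sum_(n < M) cos1 (b + n%:R * t)) = S M - S 0%N.
  rewrite -telescope_sumr// big_mkord mulr_sumr; apply: eq_bigr => n _.
  rewrite /S /sin1 /cos1 -(natr1 n).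
  have -> : 2 * pi * (b + (n%:R + 1) * t - t / 2) =
    2 * pi * (b + n%:R * t) + pi * t by field.
  have -> : 2 * pi * (b + n%:R * t - t / 2) =
    2 * pi * (b + n%:R * t) - pi * t by field.
  by rewrite sinD sinB; ring.
have : `|2 * sin (pi * t) * (\sum_(n < M) cos1 (b + n%:R * t))| <= 2.
  rewrite E; apply: le_trans (ler_normB _ _) _.
  have := sin1_le1 (b + M%:R * t - t / 2).
  have := sin1_le1 (b + 0%:R * t - t / 2); rewrite /S; lra.
by rewrite !normrM normr_nat -mulrA -{2}[2](mulr1 2) ler_pM2l.
Qed.

Lemma sin_pi_lower e : 0 < e -> e < 2^-1 ->
  0 < sin (pi * e) /\
  forall t, (forall z : int, e <= `|t - z%:~R|) -> sin (pi * e) <= `|sin (pi * t)|.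
Proof.
move=> e0 e1; have pi0 := pi_gt0 R.
have lt_mono a b' : - 2^-1 <= a -> a <= b' -> b' <= 2^-1 -> sin (pi * a) <= sin (pi * b').
  move=> ha hab hb; rewrite le_eqVlt; have [->|ne] := eqVneq a b'; first by rewrite eqxx.
  apply/orP; right; rewrite ltr_sin ?in_itv /=; first by rewrite ltr_pM2l// lt_neqAle ne.
    by apply/andP; split; nra.
  by apply/andP; split; nra.
split; first by rewrite sin_gt0_pi//; apply/andP; split; nra.
move=> t te; set f := t - (Num.floor t)%:~R.
have f0 : 0 <= f by rewrite subr_ge0 floor_le_tmp.
have f1 : f < 1 by rewrite ltrBlDr addrC -intrD1 floorD1_gt.
have fe : e <= f by have := te (Num.floor t); rewrite ger0_norm.
have fe1 : f <= 1 - e.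
  have := te (Num.floor t + 1); rewrite intrD1 opprD addrA -/f ler0_norm; lra.
(* sin(pi t) has period one only up to sign, so squares are compared. *)
have Esin : `|sin (pi * t)| = `|sin (pi * f)|.
  apply/eqP; rewrite -(eqrXn2 (n := 2))// -!normrX !sin_pi_sqr (@cos1_eq t f)//.
  by rewrite opprB addrC subrK intr_int.
rewrite Esin; apply: le_trans (ler_norm _).
have [fh|fh] := leP f 2^-1; first by apply: lt_mono => //; lra.
(* For f > 1/2 the reflection sin(pi f) = sin(pi (1 - f)) brings the argument back to the interval
   where sine increases. *)
rewrite -[sin (pi * f)]opprK -(sinDpi (pi * f)) -sinN.
rewrite -(sinD2pi (- _)).
have -> : - (pi * f + pi) + pi *+ 2 = pi * (1 - f) by rewrite mulr2n; ring.
by apply: lt_mono; lra.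
Qed.

Lemma sin_pi_gt0 t : t \isn't a Num.int -> 0 < `|sin (pi * t)|.
Proof.
move=> tZ.
(* The distance from [t] to the integers, capped by 1/4 to stay below 1/2. *)
pose d := Num.min (t - (Num.floor t)%:~R) (Num.min ((Num.floor t)%:~R + 1 - t) 4^-1).
have f0 : 0 < t - (Num.floor t)%:~R.
  rewrite subr_gt0 lt_neqAle floor_le_tmp andbT.
  by apply: contra tZ => /eqP <-; rewrite intr_int.
have f1 : 0 < (Num.floor t)%:~R + 1 - t.
  by rewrite subr_gt0 -intrD1 floorD1_gt.
have d0 : 0 < d by rewrite !lt_min f0 f1 invr_gt0 ltr0n.
have dh : d < 2^-1.
  have : d <= 4^-1 by rewrite /d !ge_min lexx !orbT.
  by move=> /le_lt_trans; apply; lra.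
have [s0 /(_ t) st] := sin_pi_lower d0 dh.
have {st} : sin (pi * d) <= `|sin (pi * t)|.
  apply: st => z; have [zt|tz] := leP z (Num.floor t).
    have {}zt : z%:~R <= (Num.floor t)%:~R :> R by rewrite ler_int.
    apply: (@le_trans _ _ (t - (Num.floor t)%:~R)); first by rewrite ge_min lexx.
    by apply: le_trans (ler_norm _); lra.
  have {}tz : (Num.floor t)%:~R + 1 <= z%:~R :> R by rewrite -intrD1 ler_int lezD1.
  apply: (@le_trans _ _ ((Num.floor t)%:~R + 1 - t)); first by rewrite !ge_min lexx orbT.
  by rewrite distrC; apply: le_trans (ler_norm _); lra.
exact: lt_le_trans.
Qed.

End Cosines.

(** * The van der Corput inequality *)

Section VanDerCorput.
Variable R : realType.
Implicit Types (f g : nat -> R) (e t : R).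

(** Cauchy-Schwarz against the constant sequence: the squared deviations from the mean have a
    nonnegative sum. *)
Lemma sqr_sum_le (Y : nat -> R) M :
  (\sum_(n < M) Y n) ^+ 2 <= M%:R * \sum_(n < M) Y n ^+ 2.
Proof.
case: M => [|M]; first by rewrite !big_ord0 expr0n mul0r.
set T := \sum_(n < M.+1) Y n; set Q := \sum_(n < M.+1) _.
have M0 : 0 < M.+1%:R :> R by rewrite ltr0n.
have : 0 <= \sum_(n < M.+1) (M.+1%:R * Y n - T) ^+ 2.
  by apply: sumr_ge0 => n _; exact: sqr_ge0.
have -> : \sum_(n < M.+1) (M.+1%:R * Y n - T) ^+ 2 =
    M.+1%:R * (M.+1%:R * Q - T ^+ 2).
  transitivity (\sum_(n < M.+1) (M.+1%:R ^+ 2 * Y n ^+ 2 -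
      2 * M.+1%:R * T * Y n + T ^+ 2)).
    by apply: eq_bigr => n _; ring.
  rewrite !big_split /= sumrN -!mulr_sumr sumr_const card_ord -/Q -/T -mulr_natr.
  ring.
by rewrite pmulr_rge0// subr_ge0.
Qed.

(** The sum is compared with its average over [H] shifts, and Cauchy-Schwarz turns the latter into
    correlations. The diagonal pairs contribute [H^-1] and the others at most [e']. *)
Lemma van_der_corput f (H : nat) e e' :
  (0 < H)%N -> 0 < e -> 0 <= e' -> H%:R^-1 + e' <= (e / 2) ^+ 2 ->
  (forall h h' : 'I_H, h != h' ->
    avg_le (fun n => cos1 (f (n + h)%N - f (n + h')%N)) e') ->
  avg_le (fun n => cos1 (f n)) e.
Proof.
move=> H0 e0 e'0 He' fH.
have H0' : 0 < H%:R :> R by rewrite ltr0n.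
have [M1 hM1] := @avg_le_sum R _ (index_enum ('I_H * 'I_H)%type)
  (fun p => p.1 != p.2)
  (fun p n => cos1 (f (n + p.1)%N - f (n + p.2)%N)) (fun=> e')
  (fun p pne => fH p.1 p.2 pne).
exists (maxn M1 (Num.truncn (4 * H%:R / e)).+1) => M.
rewrite geq_max => /andP[/hM1 off leM].
have {leM} : 4 * H%:R / e <= M%:R.
  by apply: ltW; apply: lt_le_trans (truncnS_gt _) _; rewrite ler_nat.
rewrite ler_pdivrMr// => leM.
set S := \sum_(n < M) _.
(* [Y] and [Z] are the two parts of a window sum of characters. Only [Y] is to be bounded, but
   [Y ^+ 2 + Z ^+ 2] expands into cosines of phase differences alone. *)
pose Y n := \sum_(h < H) cos1 (f (n + h)%N).
pose Z n := \sum_(h < H) sin1 (f (n + h)%N).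
have YS : `|\sum_(n < M) Y n - H%:R * S| <= 2 * H%:R * H%:R.
  rewrite /Y exchange_big /= -[X in X%:R * S]card_ord -sum1_card natr_sum mulr_suml -sumrB.
  apply: le_trans (ler_norm_sum _ _ _) _.
  apply: (@le_trans _ _ (\sum_(h < H) 2 * H%:R)); last first.
    by rewrite sumr_const card_ord [leRHS]mulr_natr.
  apply: ler_sum => h _; rewrite mul1r.
  apply: le_trans (@sum_shift_le R (fun n => cos1 (f n)) M h (fun n => cos1_le1 _)) _.
  by rewrite ler_pM2l// ler_nat ltnW.
have YZ : \sum_(n < M) (Y n ^+ 2 + Z n ^+ 2) <=
    M%:R * H%:R + H%:R ^+ 2 * (e' * M%:R).
  have E n : Y n ^+ 2 + Z n ^+ 2 = H%:R +
      \sum_(p : 'I_H * 'I_H | p.1 != p.2) cos1 (f (n + p.1)%N - f (n + p.2)%N).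
    rewrite !expr2 /Y /Z !big_distrlr /= -big_split /=.
    under eq_bigr do rewrite -big_split /=.
    rewrite pair_big /= (bigID (fun p => p.1 == p.2)) /=; congr (_ + _).
      rewrite -(pair_big_dep xpredT (fun i j => i == j)
         (fun i j : 'I_H => cos1 (f (n + i)%N) * cos1 (f (n + j)%N) +
                    sin1 (f (n + i)%N) * sin1 (f (n + j)%N))) /=.
      rewrite -[RHS](_ : \sum_(i < H) 1 = _); last by rewrite sumr_const card_ord.
      apply: eq_bigr => i _; rewrite (big_pred1 i); last by move=> j; rewrite eq_sym.
      by rewrite -cos1B subrr /cos1 mulr0 cos0.
    by apply: eq_bigr => p _; rewrite cos1B.
  under eq_bigr do rewrite E.
  rewrite big_split /= sumr_const card_ord -[_ *+ M]mulr_natl lerD2l.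
  move: off; rewrite sumr_const => off.
  apply: le_trans (ler_norm _) _; apply: le_trans off _.
  rewrite mulrA -[e' *+ _]mulr_natl ler_wpM2r// ler_wpM2r//.
  rewrite -natrX ler_nat; apply: leq_trans (max_card _) _.
  by rewrite card_prod card_ord.
have T2 : (\sum_(n < M) Y n) ^+ 2 <= (M%:R * H%:R * (e / 2)) ^+ 2.
  apply: le_trans (sqr_sum_le Y M) _.
  have : \sum_(n < M) Y n ^+ 2 <= M%:R * H%:R + H%:R ^+ 2 * (e' * M%:R).
    by apply: le_trans YZ; apply: ler_sum => n _; rewrite lerDl sqr_ge0.
  move=> /(ler_wpM2l (ler0n R M)) /le_trans; apply.
  rewrite [leRHS]exprMn (_ : M%:R * _ = (M%:R * H%:R) ^+ 2 * (H%:R^-1 + e')).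
    by rewrite ler_wpM2l// sqr_ge0.
  by field; rewrite gt_eqF.
have {}T2 : `|\sum_(n < M) Y n| <= M%:R * H%:R * (e / 2).
  rewrite -(@ler_pXn2r _ 2)// ?nnegrE//; first by rewrite real_normK// num_real.
  by rewrite !mulr_ge0// ?divr_ge0// ltW.
have : H%:R * `|S| <= H%:R * (e * M%:R).
  rewrite -[X in X * `|S|]normr_nat -normrM.
  have := ler_normB (\sum_(n < M) Y n) (\sum_(n < M) Y n - H%:R * S).
  rewrite opprB addrC subrK; nra.
by rewrite ler_pM2l.
Qed.

End VanDerCorput.

(** * Weyl sums *)

Section Differences.
Variable R : realType.
Implicit Types (f g : nat -> R) (e t c : R).

(* [f] agrees with a polynomial of degree at most [d] whose coefficient of
   degree [d] is [t / d`!] *)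
Fixpoint iter_diff d f t : Prop :=
  if d is d'.+1 then forall h, iter_diff d' (fun n => f (n + h)%N - f n) (h%:R * t)
  else forall n, f n = t.

Lemma iter_diff_shift d f t k : iter_diff d f t -> iter_diff d (fun n => f (n + k)%N) t.
Proof.
elim: d f t => [|d IH] f t /= ft; first by move=> n; exact: ft.
move=> h; rewrite (_ : (fun n => _) = fun n => f (n + k + h)%N - f (n + k)%N).
  exact: IH (ft h).
by apply/funext => n; rewrite addnAC.
Qed.

Lemma iter_diffD d f g t s : iter_diff d f t -> iter_diff d g s ->
  iter_diff d (fun n => f n + g n) (t + s).
Proof.
elim: d f g t s => [|d IH] f g t s /= ft gs; first by move=> n; rewrite ft gs.
move=> h; rewrite (_ : (fun n => _) =
    fun n => (f (n + h)%N - f n) + (g (n + h)%N - g n)).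
  by rewrite mulrDr; exact: IH.
by apply/funext => n; ring.
Qed.

Lemma iter_diffM d f t c : iter_diff d f t -> iter_diff d (fun n => c * f n) (c * t).
Proof.
elim: d f t => [|d IH] f t /= ft; first by move=> n; rewrite ft.
move=> h; rewrite (_ : (fun n => _) = fun n => c * (f (n + h)%N - f n)).
  by rewrite mulrCA; exact: IH.
by apply/funext => n; ring.
Qed.

Lemma iter_diffS d f t : iter_diff d f t -> iter_diff d.+1 f 0.
Proof.
elim: d f t => [|d IH] f t /= ft h; first by move=> n; rewrite !ft subrr mulr0.
by move=> h'; rewrite mulr0; exact: (IH _ _ (ft h)).
Qed.

(** Discrete product rule: the increment of the product is the linear factor times the increment of
    [f], treated by induction, plus [r * h] times a shift of [f]. *)
Lemma iter_diff_linear d f t (r s : R) : iter_diff d f t ->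
  iter_diff d.+1 (fun n => (r * n%:R + s) * f n) (d.+1%:R * r * t).
Proof.
elim: d f t => [|d IH] f t ft.
  by move=> h n /=; rewrite /= in ft; rewrite !ft natrD; ring.
move=> h.
rewrite (_ : (fun n => _) = fun n => (r * n%:R + s) * (f (n + h)%N - f n) +
    r * h%:R * f (n + h)%N); last by apply/funext => n; rewrite natrD; ring.
rewrite (_ : h%:R * _ = d.+1%:R * r * (h%:R * t) + r * h%:R * t).
  by apply: iter_diffD; [exact/IH/ft|exact/iter_diffM/iter_diff_shift].
by rewrite -[d.+2%:R]natr1; ring.
Qed.

Lemma iter_diff_pow d (r s : R) :
  iter_diff d (fun n => (r * n%:R + s) ^+ d) (d`!%:R * r ^+ d).
Proof.
elim: d => [|d IH]; first by move=> n; rewrite !expr0 fact0 mulr1.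
rewrite (_ : (fun n => _) = fun n => (r * n%:R + s) * (r * n%:R + s) ^+ d).
  rewrite factS natrM exprS (_ : _ * _ = d.+1%:R * r * (d`!%:R * r ^+ d)); last ring.
  exact: iter_diff_linear.
by apply/funext => n; rewrite exprS.
Qed.

Lemma iter_diff_poly d (a : nat -> R) (r s : R) :
  iter_diff d (fun n => \sum_(i < d.+1) a i * (r * n%:R + s) ^+ i)
    (d`!%:R * r ^+ d * a d).
Proof.
rewrite [X in iter_diff _ X](_ : _ = fun n => \sum_(i < d) a i * (r * n%:R + s) ^+ i +
   a d * (r * n%:R + s) ^+ d); last by apply/funext => n; rewrite big_ord_recr.
rewrite -[X in iter_diff _ _ X]add0r; apply: iter_diffD; last first.
  by rewrite mulrC; exact/iter_diffM/iter_diff_pow.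
elim: d => [|d IH]; first by move=> n; rewrite big_ord0.
rewrite [X in iter_diff _ X](_ : _ = fun n => \sum_(i < d) a i * (r * n%:R + s) ^+ i +
   a d * (r * n%:R + s) ^+ d); last by apply/funext => n; rewrite big_ord_recr.
rewrite -[X in iter_diff _ _ X](addr0 0).
apply: iter_diffD; first exact: iter_diffS IH.
exact/iter_diffS/iter_diffM/iter_diff_pow.
Qed.

End Differences.

Section Weyl.
Variable R : realType.
Implicit Types (f g : nat -> R) (e t c : R).

(** Covers both cases at once: [t] is irrational, or rational with reduced denominator above [Q]. *)
Definition big_denom (Q : nat) t :=
  forall q, (0 < q <= Q)%N -> q%:R * t \isn't a Num.int.

Lemma sub_big_denom P Q t : (P <= Q)%N -> big_denom Q t -> big_denom P t.
Proof.
move=> PQ Qt q /andP[q0 qP]; apply: Qt; rewrite q0; exact: leq_trans PQ.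
Qed.

Lemma big_denomM P Q h t : (0 < h <= P)%N -> big_denom (Q * P) t ->
  big_denom Q (h%:R * t).
Proof.
move=> /andP[h0 hP] Qt q /andP[q0 qQ]; rewrite mulrA -natrM; apply: Qt.
by rewrite muln_gt0 q0 h0 leq_mul.
Qed.

Lemma avg_le_linear f t e : 0 < e -> iter_diff 1 f t -> t \isn't a Num.int ->
  avg_le (fun n => cos1 (f n)) e.
Proof.
move=> e0 ft tZ.
have Ef n : f n = f 0%N + n%:R * t.
  by have /= := ft n 0%N; rewrite add0n => <-; rewrite addrC subrK.
have st := sin_pi_gt0 tZ.
apply: (@avg_le_bounded _ _ _ (`|sin (pi * t)|^-1)) => // M.
rewrite -[leRHS]mul1r ler_pdivlMr// mulrC.
by under eq_bigr do rewrite Ef; exact: sum_cos1_le.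
Qed.

(** Weyl differencing: van der Corput lowers the degree by one and multiplies the leading parameter
    by a shift difference of at most [H], so [Q] grows by the factor [H]. It depends on [d] and [e]
    only, not on [f]. *)
Lemma weyl_leading d e : 0 < e -> exists2 Q, (0 < Q)%N &
  forall f t, iter_diff d.+1 f t -> big_denom Q t -> avg_le (fun n => cos1 (f n)) e.
Proof.
elim: d e => [|d IH] e e0.
  exists 1%N => // f t ft /(_ 1%N); rewrite mul1r => tZ.
  exact: avg_le_linear ft (tZ _).
(* Half of the allowance of van der Corput goes to [H^-1], half to the correlations; these are
   bounded by [e' / 2] before a shift of the origin. *)
pose e' := (e / 2) ^+ 2 / 2.
have e'0 : 0 < e' by rewrite divr_gt0 ?exprn_gt0 ?divr_gt0.
have [Q Q0 hQ] := IH (e' / 2) ltac:(by rewrite divr_gt0).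
pose H := (Num.truncn e'^-1).+1.
exists (Q * H)%N; first by rewrite muln_gt0 Q0.
move=> f t ft tQ; apply: (@van_der_corput _ f H _ e') => //; first exact: ltW.
  have : H%:R^-1 <= e'.
    rewrite -[e']invrK lef_pV2 ?posrE ?invr_gt0 ?ltr0n//.
    by apply: ltW; apply: truncnS_gt.
  by rewrite /e'; lra.
have main (h h' : 'I_H) : (h' < h)%N ->
    avg_le (fun n => cos1 (f (n + h)%N - f (n + h')%N)) e'.
  move=> hh.
  rewrite (_ : (fun n => _) = fun n =>
     cos1 (f (n + h' + (h - h'))%N - f (n + h')%N)); last first.
    by apply/funext => n; rewrite -addnA (subnKC (ltnW hh)).
  apply: (@avg_le_shift _ (fun n => cos1 (f (n + (h - h'))%N - f n)) (e' / 2)).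
  - by move=> n; exact: cos1_le1.
  - by rewrite ltr_pdivrMr//; lra.
  - apply: hQ (ft _) _; apply: big_denomM tQ.
    by rewrite subn_gt0 hh /= (leq_trans (leq_subr _ _))// ltnW.
move=> h h' hh'.
have [lt|lt|/val_inj eq] := ltngtP h h'; last by rewrite eq eqxx in hh'.
  rewrite (_ : (fun n => _) = fun n => cos1 (f (n + h')%N - f (n + h)%N)).
    exact: main.
  by apply/funext => n; rewrite -[LHS]cos1N opprB.
exact: main.
Qed.

(* A top coefficient with small denominator [q] contributes a constant on each
   residue class mod [q]; the scale [r] keeps track of the substitutions
   [n = q n' + s]. *)
Lemma weyl_affine D e r : 0 < e -> (0 < r)%N -> exists Q,
  forall (s : nat) (a : nat -> R),
    (exists2 d, (0 < d <= D)%N & big_denom Q (a d)) ->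
    avg_le (fun n => cos1 (\sum_(i < D.+1) a i * (r%:R * n%:R + s%:R) ^+ i)) e.
Proof.
elim: D e r => [|D IH] e r e0 r0.
  by exists 0%N => s a [[|d]].
have [Q0 Q00 hQ0] := weyl_leading D e0.
pose K := (Q0 * (D.+1`! * r ^ D.+1))%N.
have e20 : 0 < e / 2 by rewrite divr_gt0.
have /choice[Qf hQf] : forall q, exists Q, (0 < q)%N -> forall (s : nat) (a : nat -> R),
    (exists2 d, (0 < d <= D)%N & big_denom Q (a d)) ->
    avg_le (fun n => cos1 (\sum_(i < D.+1) a i * ((r * q)%:R * n%:R + s%:R) ^+ i)) (e / 2).
  move=> [|q]; first by exists 0%N.
  by have [|Q hQ] := IH (e / 2) (r * q.+1)%N e20; [rewrite muln_gt0 r0|exists Q].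
exists (maxn K (\max_(q < K.+1) Qf q)) => s a [d /andP[d0 dD] ad].
have [aK|/existsNP[q /not_implyP[/andP[q0 qK] /negP]]] := pselect (big_denom K (a D.+1)).
  apply: hQ0 (iter_diff_poly D.+1 a r%:R s%:R) _.
  by rewrite -natrX -natrM; apply: big_denomM aK; rewrite muln_gt0 fact_gt0 expn_gt0 r0 leqnn.
rewrite negbK => qa.
(* The coefficient assumed to have a large denominator is not the top one, since [q <= K] makes
   [q * a D.+1] an integer. *)
have {dD} dD : (d <= D)%N.
  move: dD; rewrite leq_eqVlt => /predU1P[dD|//].
  by move: qa; rewrite -dD (negbTE (ad q _))// q0 leq_max qK.
apply: (@avg_le_residues _ _ (e / 2) _ q) => //.
- by move=> n; exact: cos1_le1.
- exact: ltW.
- by rewrite ltr_pdivrMr//; lra.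
move=> s' _; set s2 := (r * s' + s)%N.
(* On this residue class the top monomial is constant mod 1, equal to its value at [s2]; it is moved
   into the coefficient of degree 0. *)
pose a' i := a i + (if i == 0%N then a D.+1 * s2%:R ^+ D.+1 else 0).
rewrite (_ : (fun n => _) = fun n =>
   cos1 (\sum_(i < D.+1) a' i * ((r * q)%:R * n%:R + s2%:R) ^+ i)).
  apply: (hQf q q0); exists d; first by rewrite d0.
  rewrite /a' -[d == 0%N]negbK -lt0n d0 addr0.
  apply: sub_big_denom ad; rewrite leq_max; apply/orP; right.
  have qK1 : (q < K.+1)%N by [].
  exact: (@leq_bigmax _ (fun q : 'I_K.+1 => Qf q) (Ordinal qK1)).
apply/funext => n; apply: cos1_eq.
have -> : r%:R * (q * n + s')%:R + s%:R = (r * q)%:R * n%:R + s2%:R :> R.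
  by rewrite /s2 !natrD !natrM; ring.
rewrite big_ord_recr /= [X in _ - X](_ : _ = \sum_(i < D.+1) a i *
   ((r * q)%:R * n%:R + s2%:R) ^+ i + a D.+1 * s2%:R ^+ D.+1); last first.
  rewrite [LHS]big_ord_recl [X in _ = X + _]big_ord_recl /a' /= !expr0 !mulr1 addrAC.
  by congr (_ + _ + _); apply: eq_bigr => i _; rewrite addr0.
(* The difference of the powers at [r q n + s2] and at [s2] is a multiple of [q], which clears the
   denominator of [a D.+1]. *)
rewrite opprD addrACA subrr add0r -mulrBr subrXX addrK; set S := \sum_(i < D.+1) _.
have SZ : S \is a Num.int.
  by apply: rpred_sum => i _; rewrite rpredM// rpredX// ?rpredD ?rpredM ?natr_int.
have -> : a D.+1 * ((r * q)%:R * n%:R * S) = q%:R * a D.+1 * (r * n)%:R * S.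
  by rewrite !natrM; clearbody S; ring.
by rewrite rpredM// rpredM// natr_int.
Qed.

End Weyl.

(** * Simultaneous approximation by Fejer kernels *)

Section Fejer.
Variable R : realType.
Implicit Types (t b e d : R) (M : nat).

(** The Fejer kernel, as [M^-1] times the squared modulus of a geometric sum of characters. *)
Definition fejer M t : R := M%:R^-1 *
  ((\sum_(m < M) cos1 (m%:R * t)) ^+ 2 + (\sum_(m < M) sin1 (m%:R * t)) ^+ 2).

Lemma fejer_ge0 M t : 0 <= fejer M t.
Proof. by rewrite mulr_ge0 ?invr_ge0// addr_ge0 ?sqr_ge0. Qed.

Lemma fejer_cos1 M t b : fejer M t * cos1 b = M%:R^-1 *
  \sum_(p : 'I_M * 'I_M) cos1 (b + (p.1%:R - p.2%:R) * t).
Proof.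
rewrite /fejer -mulrA; congr (_ * _).
set C := \sum_(m < M) cos1 _; set S := \sum_(m < M) sin1 _.
pose c (m : 'I_M) := cos1 (m%:R * t); pose s (m : 'I_M) := sin1 (m%:R * t).
(* The part carrying [sin1 b] is antisymmetric in the two indices and sums to zero. *)
have -> : \sum_(p : 'I_M * 'I_M) cos1 (b + (p.1%:R - p.2%:R) * t) =
  \sum_(p : 'I_M * 'I_M) (cos1 b * (c p.1 * c p.2 + s p.1 * s p.2) -
     sin1 b * (s p.1 * c p.2 - c p.1 * s p.2)).
  apply: eq_bigr => p _.
  rewrite /c /s /cos1 /sin1 (_ : 2 * pi * (b + (p.1%:R - p.2%:R) * t) =
    2 * pi * b + (2 * pi * (p.1%:R * t) - 2 * pi * (p.2%:R * t))); last ring.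
  by rewrite cosD cosB sinB.
rewrite -(pair_bigA _ (fun i j : 'I_M => cos1 b * (c i * c j + s i * s j) -
     sin1 b * (s i * c j - c i * s j))) /=.
transitivity (\sum_(i < M) (cos1 b * (c i * C + s i * S) - sin1 b * (s i * C - c i * S))).
  rewrite sumrB -!mulr_sumr big_split sumrB /= -!mulr_suml -/C -/S; ring.
apply: eq_bigr => i _.
by rewrite sumrB -!mulr_sumr big_split sumrB /= -!mulr_sumr.
Qed.

Lemma fejer_cos0 M t : (0 < M)%N -> fejer M t = 1 + M%:R^-1 *
  \sum_(p : 'I_M * 'I_M | p.1 != p.2) cos1 ((p.1%:R - p.2%:R) * t).
Proof.
move=> M0; have cos10 : cos1 0 = 1 :> R by rewrite /cos1 mulr0 cos0.
have := fejer_cos1 M t 0; rewrite cos10 mulr1 => ->; rewrite (bigID (fun p => p.1 == p.2)) /= mulrDr.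
congr (_ + _); last by congr (_ * _); apply: eq_bigr => p _; rewrite add0r.
rewrite -(pair_big_dep xpredT (fun i j => i == j)
         (fun i j : 'I_M => cos1 (0 + (i%:R - j%:R) * t))) /=.
rewrite (eq_bigr (fun=> 1)); last first.
  move=> i _; rewrite (big_pred1 i); last by move=> j; rewrite eq_sym.
  by rewrite subrr mul0r addr0 cos10.
by rewrite sumr_const card_ord mulVf // pnatr_eq0 -lt0n.
Qed.

(** At distance at least [e] from the integers, the cosine and sine sums are at most [s^-1], so the
    kernel is at most 2 / (M s^2), which is below [d] for [M] large. *)
Lemma fejer_small e d : 0 < e -> 0 < d -> exists2 M, (0 < M)%N &
  forall t, d < fejer M t -> exists z : int, `|t - z%:~R| < e.
Proof.
move=> e0 d0; pose e' := Num.min e 4^-1.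
have e'0 : 0 < e' by rewrite lt_min e0 invr_gt0 ltr0n.
have e'h : e' < 2^-1.
  have : e' <= 4^-1 by rewrite ge_min lexx orbT.
  lra.
have [s0 hs] := sin_pi_lower e'0 e'h; set s := sin (pi * e') in s0 hs.
have ds0 : 0 < d * s ^+ 2 by rewrite mulr_gt0 ?exprn_gt0.
pose M := (Num.truncn (2 / (d * s ^+ 2))).+1; exists M => // t dt.
apply: contrapT => /forallNP far.
have {hs} st : s <= `|sin (pi * t)|.
  apply: hs => z; have /negP := far z; rewrite -leNgt; apply: le_trans.
  by rewrite ge_min lexx.
have : 2 / (d * s ^+ 2) < M%:R by apply: truncnS_gt.
rewrite ltr_pdivrMr// => ltM.
have M0 : 0 < M%:R :> R by rewrite ltr0n.
move: dt; rewrite /fejer mulrC ltr_pdivlMr//.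
set C := \sum_(m < M) cos1 _; set S := \sum_(m < M) sin1 _ => dt.
have sq x : `|sin (pi * t)| * `|x| <= 1 -> s ^+ 2 * x ^+ 2 <= 1.
  move=> hx; rewrite -[x ^+ 2]real_normK ?num_real// -exprMn.
  apply: exprn_ile1; first by rewrite mulr_ge0// ltW.
  by apply: le_trans hx; rewrite ler_wpM2r.
have hC : s ^+ 2 * C ^+ 2 <= 1.
  apply: sq; have := sum_cos1_le 0 t M.
  by under eq_bigr do rewrite add0r.
have hS : s ^+ 2 * S ^+ 2 <= 1.
  apply: sq; rewrite /S; under eq_bigr do rewrite sin1E addrC.
  exact: sum_cos1_le.
have s20 : 0 < s ^+ 2 by rewrite exprn_gt0.
nra.
Qed.

Section Product.
Variables (J : eqType) (g : J -> nat -> R) (M : nat) (e : R).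
Hypotheses (M0 : (0 < M)%N) (e0 : 0 <= e).

Let dist_ord (a b : 'I_M) : `|a%:Z - b%:Z| <= M%:Z.
Proof. by have := ltn_ord a; have := ltn_ord b; lia. Qed.

(** The kernels are expanded one by one, the phase [b] collecting the frequencies chosen so far.
    Each expansion has [M * M] terms of weight [M^-1], hence costs a factor [M]. *)
Lemma avg_le_fejer_prod (r : seq J) (b : nat -> R) : uniq r ->
  (forall m : J -> int, (forall j, `|m j| <= M%:Z) ->
    avg_le (fun n => cos1 (b n + \sum_(j <- r) (m j)%:~R * g j n)) e) ->
  avg_le (fun n => \prod_(j <- r) fejer M (g j n) * cos1 (b n)) (M%:R ^+ size r * e).
Proof.
elim: r b => [|j r IH] b /=.
  move=> _ /(_ (fun=> 0)) h; rewrite expr0 mul1r.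
  rewrite [X in avg_le X](_ : _ = fun n => cos1 (b n +
      \sum_(j <- [::]) (0 : int)%:~R * g j n)); last first.
    by apply/funext => n; rewrite !big_nil mul1r addr0.
  by apply: h => j; rewrite normr0.
move=> /andP[jr ur] h.
rewrite [X in avg_le X](_ : _ = fun n => M%:R^-1 * \sum_(p : 'I_M * 'I_M)
   (\prod_(i <- r) fejer M (g i n) * cos1 (b n + (p.1%:R - p.2%:R) * g j n))); last first.
  apply/funext => n; rewrite big_cons mulrAC fejer_cos1 -mulrA; congr (_ * _).
  by rewrite mulrC mulr_sumr.
have Mr0 : 0 < M%:R :> R by rewrite ltr0n.
have -> : M%:R ^+ (size r).+1 * e =
   `|M%:R^-1| * \sum_(p : 'I_M * 'I_M) (M%:R ^+ size r * e).
  rewrite sumr_const card_prod card_ord ger0_norm ?invr_ge0//.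
  rewrite -[_ *+ (M * M)]mulr_natl natrM exprS; field.
  by rewrite gt_eqF.
apply: avg_leM; apply: avg_le_sum => p _; apply: IH => // m hm.
pose m' i := if i == j then p.1%:Z - p.2%:Z else m i.
rewrite [X in avg_le X](_ : _ = fun n => cos1 (b n +
   \sum_(i <- j :: r) (m' i)%:~R * g i n)).
  apply: h => i; rewrite /m'; case: eqP => // _; exact: dist_ord.
apply/funext => n; rewrite big_cons addrA; congr (cos1 (_ + _ + _)).
  by rewrite /m' eqxx rmorphB.
apply: eq_big_seq => i ir; rewrite /m'.
by case: eqP ir jr => [-> ->|].
Qed.

(** The diagonal of the first kernel reproduces the product of the others, treated by induction;
    every off-diagonal term has a nonzero frequency at [j], and the previous estimate applies to
    it. *)
Lemma avg_le_fejer_prod1 (r : seq J) : uniq r ->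
  (forall m : J -> int, (forall j, `|m j| <= M%:Z) -> (exists2 j, j \in r & m j != 0) ->
    avg_le (fun n => cos1 (\sum_(j <- r) (m j)%:~R * g j n)) e) ->
  avg_le (fun n => \prod_(j <- r) fejer M (g j n) - 1)
    ((size r)%:R * M%:R ^+ size r * e).
Proof.
elim: r => [|j r IH] /=.
  move=> _ _; rewrite !mul0r [X in avg_le X](_ : _ = fun=> 0).
    exact: avg_le0.
  by apply/funext => n; rewrite big_nil subrr.
move=> /andP[jr ur] h.
have Mr1 : 1 <= M%:R :> R by rewrite ler1n.
have Mr0 : 0 < M%:R :> R by rewrite ltr0n.
rewrite [X in avg_le X](_ : _ = fun n => (\prod_(i <- r) fejer M (g i n) - 1) +
   M%:R^-1 * \sum_(p : 'I_M * 'I_M | p.1 != p.2)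
   (\prod_(i <- r) fejer M (g i n) * cos1 ((p.1%:R - p.2%:R) * g j n))); last first.
  apply/funext => n; rewrite big_cons fejer_cos0// mulrDl mul1r addrAC; congr (_ + _).
  by rewrite -mulrA; congr (_ * _); rewrite mulrC mulr_sumr.
have ext (m : J -> int) k : (fun n => (k%:~R * g j n) + \sum_(i <- r) (m i)%:~R * g i n) =
    (fun n => \sum_(i <- j :: r) (if i == j then k else m i)%:~R * g i n).
  apply/funext => n; rewrite big_cons eqxx; congr (_ + _).
  apply: eq_big_seq => i ir.
  by case: eqP ir jr => [-> ->|].
apply: (@avg_leW _ _ ((size r)%:R * M%:R ^+ size r * e + `|M%:R^-1| *
    \sum_(p : 'I_M * 'I_M | p.1 != p.2) (M%:R ^+ size r * e))).
  have X0 : 0 <= M%:R ^+ size r * e by rewrite mulr_ge0 ?exprn_ge0.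
  have le1 : `|M%:R^-1| * \sum_(p : 'I_M * 'I_M | p.1 != p.2) (M%:R ^+ size r * e) <=
      M%:R * (M%:R ^+ size r * e).
    rewrite sumr_const ger0_norm ?invr_ge0//.
    move: X0; set X := _ * e => X0; rewrite -[X *+ _]mulr_natl mulrA ler_wpM2r//.
    rewrite ler_pdivrMl// -natrM ler_nat; apply: leq_trans (max_card _) _.
    by rewrite card_prod card_ord.
  rewrite -[(size r).+1%:R]natr1 exprS -!mulrA mulrDl mul1r lerD//.
  by rewrite ler_wpM2l// ler_peMl.
apply: avg_leD.
  apply: IH => // m hm [i ir mi].
  have := congr1 (fun f n => cos1 (f n)) (ext m 0) => /= E.
  rewrite [X in avg_le X](_ : _ = fun n =>
      cos1 (0%:~R * g j n + \sum_(i <- r) (m i)%:~R * g i n)); last first.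
    by apply/funext => n; rewrite mul0r add0r.
  rewrite E; apply: h.
    by move=> k; case: eqP => // _; rewrite normr0.
  exists i; first by rewrite inE ir orbT.
  by rewrite ifN//; apply: contraNneq jr => <-.
apply: avg_leM; apply: avg_le_sum => p pne.
apply: avg_le_fejer_prod => // m hm.
have := congr1 (fun f n => cos1 (f n)) (ext m (p.1%:Z - p.2%:Z)) => /= E.
rewrite [X in avg_le X](_ : _ = fun n =>
    cos1 ((p.1%:Z - p.2%:Z)%:~R * g j n + \sum_(i <- r) (m i)%:~R * g i n)); last first.
  by apply/funext => n; rewrite rmorphB.
rewrite E; apply: h.
  by move=> k; case: eqP => // _; exact: dist_ord.
exists j; first by rewrite inE eqxx.
by rewrite eqxx subr_eq0 eqz_nat.
Qed.

End Product.

(* If [G n] below is never positive then its averages cannot be close to their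
   expected value [1 - d K]; and where it is positive all the [fejer M (g j n)] exceed [d]. *)
Lemma joint_approximation (K : nat) d : 0 < d -> exists (M : nat) (e : R), 0 < e /\
  forall (J : eqType) (r : seq J) (g : J -> nat -> R), uniq r -> size r = K ->
  (forall m : J -> int, (forall j, `|m j| <= M%:Z) -> (exists2 j, j \in r & m j != 0) ->
    avg_le (fun n => cos1 (\sum_(j <- r) (m j)%:~R * g j n)) e) ->
  exists n, forall j, j \in r -> exists z : int, `|g j n - z%:~R| < d.
Proof.
(* As c K < 1/2, the expected average 1 - c K of [G] stays above 1/2. *)
move=> d0; pose c : R := (2 * K.+1%:R)^-1.
have c0 : 0 < c by rewrite invr_gt0 mulr_gt0 ?ltr0n.
have [M M0 hM] := fejer_small d0 c0.
have Mr1 : 1 <= M%:R :> R by rewrite ler1n.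
have MK1 : 1 <= M%:R ^+ K :> R by rewrite exprn_ege1.
(* This puts the average of every product of kernels within 1/4 of 1, so that the total error
   remains below 1/2. *)
pose e : R := (4 * (K.+1%:R * M%:R ^+ K))^-1.
have K0 : 0 < K.+1%:R :> R by rewrite ltr0n.
have e0 : 0 < e by rewrite invr_gt0 !mulr_gt0//; lra.
exists M, e; split=> // J r g ur sr hr.
pose P (s : seq J) n := \prod_(j <- s) fejer M (g j n).
have P0 s n : 0 <= P s n by apply: prodr_ge0 => j _; exact: fejer_ge0.
pose G n := P r n - c * \sum_(j <- r) P (rem j r) n.
have Prem j n : j \in r -> P r n = fejer M (g j n) * P (rem j r) n.
  by move=> jr; rewrite /P (perm_big _ (perm_to_rem jr)) big_cons.
have [[n Gn]|/forallNP Gle0] := pselect (exists n, 0 < G n).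
  exists n => j jr; apply: hM; move: Gn; rewrite /G subr_gt0 (Prem j)//.
  rewrite (perm_big _ (perm_to_rem jr)) big_cons.
  have S0 : 0 <= \sum_(i <- rem j r) P (rem i r) n by apply: sumr_ge0.
  (* A kernel value at most [c] would make [P r n] at most one term of the subtracted sum. *)
  rewrite !ltNge; apply: contra => Fc; apply: ler_pM => //; first exact: fejer_ge0.
  by rewrite lerDl.
exfalso.
have avgr : avg_le (fun n => P r n - 1) (K%:R * M%:R ^+ K * e).
  by rewrite -sr; apply: avg_le_fejer_prod1 => //; exact: ltW.
have avgj j : j \in r -> avg_le (fun n => P (rem j r) n - 1) (K%:R * M%:R ^+ K * e).
  move=> jr; apply: (@avg_leW _ _ ((size (rem j r))%:R * M%:R ^+ size (rem j r) * e)).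
    rewrite size_rem// sr; apply: ler_wpM2r; first exact: ltW.
    by apply: ler_pM => //; rewrite ?ler_nat ?leq_pred// ler_weXn2l// leq_pred.
  apply: avg_le_fejer_prod1 => //; [exact: ltW|exact: rem_uniq|].
  move=> m hm [i ir mi]; have ij : i != j.
    by apply: contraTneq ir => ->; rewrite mem_rem_uniqF.
  rewrite [X in avg_le X](_ : _ = fun n =>
      cos1 (\sum_(i <- r) (if i == j then 0 else m i)%:~R * g i n)).
    apply: hr; first by move=> k; case: eqP => // _; rewrite normr0.
    by exists i; [exact: mem_rem ir|rewrite (negbTE ij)].
  apply/funext => n; rewrite (perm_big _ (perm_to_rem jr)) big_cons eqxx /= mulr0z mul0r add0r.
  congr cos1; apply: eq_big_seq => k.
  by rewrite mem_rem_uniq// inE => /andP[/negbTE -> _].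
have := avg_leD avgr (avg_leM (- c) (@avg_le_sum R _ r (mem r)
   (fun j n => P (rem j r) n - 1) (fun=> K%:R * M%:R ^+ K * e) avgj)).
set E := (X in avg_le _ X).
have cK : c * K%:R < 2^-1.
  by rewrite /c mulrC ltr_pdivrMr ?mulr_gt0// mulKf ?pnatr_eq0// ltr_nat.
have El : E < 2^-1.
  rewrite /E -big_seq big_const_seq iter_addr_0 count_predT sr normrN (gtr0_norm c0).
  have -> : K%:R * M%:R ^+ K * e = K%:R / K.+1%:R / 4.
    by rewrite /e; field; rewrite !gt_eqF//; lra.
  set x := _ / 4; have x4 : x < 4^-1.
    by rewrite /x ltr_pdivrMr// mulVf ?pnatr_eq0// ltr_pdivrMr// mul1r ltr_nat.
  have x0 : 0 <= x by rewrite !divr_ge0.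
  by rewrite -[x *+ K]mulr_natl mulrA; nra.
move=> [M1 hM1].
(* If [G] is never positive, the summand is at most c K - 1 < -1/2 at every [n], against the
   averaged bound [E] < 1/2. *)
have := hM1 M1.+1 (leqnSn _); rewrite leNgt => /negP; apply.
apply: (@lt_le_trans _ _ (2^-1 * M1.+1%:R)); first by rewrite ltr_pM2r ?ltr0n.
rewrite -normrN; apply: le_trans (ler_norm _).
have -> : 2^-1 * M1.+1%:R = \sum_(n < M1.+1) 2^-1 :> R.
  by rewrite sumr_const card_ord mulr_natr.
rewrite -sumrN.
apply: ler_sum => n _.
have /negP := Gle0 n; rewrite -leNgt /G => Gn.
rewrite -big_seq sumrB big_const_seq iter_addr_0 count_predT sr -/(P _ _).
rewrite mulrBr mulNr; lra.
Qed.

End Fejer.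

(** * Generic sets *)

Lemma sub_mxE (V : zmodType) m n (B C : 'M[V]_(m, n)) i j :
  (B - C) i j = B i j - C i j.
Proof. by rewrite !mxE. Qed.

Section Generic.
Variables (R : realType) (N : nat).
Implicit Types (V : set 'cV[R]_N) (x : 'cV[R]_N) (m : 'rV[int]_N).

Definition pairing m x : R := (map_mx intr m *m x) 0 0.

Lemma pairing0 x : pairing 0 x = 0.
Proof. by rewrite /pairing map_mx0 mul0mx mxE. Qed.

Lemma pairingZ (q : int) m x : pairing (q *: m) x = q%:~R * pairing m x.
Proof. by rewrite /pairing map_mxZ -scalemxAl mxE. Qed.

Lemma pairing_act L (u : 'rV[int]_L) (B : 'M[int]_(L, N)) x :
  pairing (u *m B) x = \sum_l (u 0 l)%:~R * (map_mx intr B *m x) l 0.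
Proof.
rewrite /pairing map_mxM -mulmxA mxE; apply: eq_bigr => l _.
by rewrite mxE.
Qed.

(* no infinite subset of [V] lies, modulo [Z^N], in a coset of a proper closed
   subgroup of the torus *)
Definition generic V := forall m, m != 0 -> forall c : R,
  finite_set (V `&` [set x | pairing m x - c \is a Num.int]).

(** The points are chosen successively. Only finitely many tuples of bounded rows exist, and each
    with nonzero last row excludes finitely many candidates for the new point; a zero last row
    reduces to the earlier points. *)
Lemma generic_choice V (B k : nat) : infinite_set V -> generic V ->
  exists x : nat -> 'cV[R]_N, (forall i, V (x i)) /\
  forall m : nat -> 'rV[int]_N, (forall i j, `|m i 0 j| <= B%:Z) ->
    (exists2 i : nat, (i < k)%N & m i != 0) ->
    \sum_(i < k) pairing (m i) (x i) \isn't a Num.int.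
Proof.
move=> Vinf Vgen; elim: k => [|k [x [xV IH]]].
  have [x Vx] := infinite_setN0 Vinf.
  by exists (fun=> x); split=> // m _ [].
(* Tuples of rows with entries in [-B, B] are encoded by finite functions into ['I_(B + B).+1],
   shifted by [B]. *)
pose W (f : {ffun 'I_k.+1 * 'I_N -> 'I_(B + B).+1}) : set 'cV[R]_N :=
  let m (i : nat) : 'rV[int]_N := \row_j ((f (inord i, j))%:Z - B%:Z) in
  if m k == 0 then set0 else
  V `&` [set y | pairing (m k) y - - \sum_(i < k) pairing (m i) (x i) \is a Num.int].
have Wfin : finite_set (\bigcup_(f in [set: {ffun 'I_k.+1 * 'I_N -> 'I_(B + B).+1}]) W f).
  apply: bigcup_finite; first exact: finite_finset.
  move=> f _; rewrite /W; case: ifP => [_|/negbT mk]; first exact: finite_set0.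
  exact: Vgen.
have [y [Vy yW]] := infinite_setN0 (infinite_setD Vinf Wfin).
exists (fun i => if i == k then y else x i); split.
  by move=> i; case: ifP.
move=> m mB [i ik mi]; rewrite big_ord_recr /= eqxx.
under eq_bigr => j _ do rewrite (ltn_eqF (ltn_ord j)).
have [mk|mk] := eqVneq (m k) 0.
  rewrite mk pairing0 addr0; apply: IH => //; exists i => //.
  by move: ik; rewrite ltnS leq_eqVlt => /predU1P[ik|//]; rewrite ik mk eqxx in mi.
apply/negP => Z; apply: yW.
pose f : {ffun 'I_k.+1 * 'I_N -> 'I_(B + B).+1} :=
  [ffun p : 'I_k.+1 * 'I_N => inord (absz (m p.1 0 p.2 + B%:Z))].
have fE a : (a <= k)%N -> (\row_j ((f (inord a, j))%:Z - B%:Z)) = m a :> 'rV[int]_N.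
  move=> ak; apply/rowP => j; rewrite mxE ffunE /= (inordK (ak : (a < k.+1)%N)).
  have := mB a j => mBa; rewrite inordK; lia.
exists f => //; rewrite /W fE// (negbTE mk); split=> //=.
rewrite opprK addrC; move: Z; congr (_ + _ \is a _).
by apply: eq_bigr => j _; rewrite fE// ltnW.
Qed.

(** Each point [s] of a grid of mesh [q^-1] gets its own point [y s] of [V], and one [n] must bring
    all the images close to their grid points in the coordinates of [I]. Any nonzero frequency
    yields a polynomial phase in [n] to which the Weyl estimate applies. *)
Lemma generic_dense (D L : nat) (A_ : 'I_D.+1 -> 'M[int]_(L, N)) (I : pred 'I_L) V (e : R) :
  infinite_set V -> generic V -> 0 < e ->
  (forall u : 'rV[int]_L, (forall l, ~~ I l -> u 0 l = 0) -> u != 0 ->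
    exists2 d : 'I_D.+1, (0 < d)%N & u *m A_ d != 0) ->
  exists n : nat, forall t : 'cV[R]_L, exists2 x, V x & forall l, I l ->
    exists z : int,
    `|(\sum_(d < D.+1) n%:R ^+ d *: (map_mx intr (A_ d) *m x) - t) l 0 - z%:~R| < e.
Proof.
move=> Vinf Vgen e0 indep.
pose q := (Num.truncn (2 / e)).+1.
have q0 : 0 < q%:R :> R by rewrite ltr0n.
have eq2 : q%:R^-1 < e / 2.
  by rewrite invf_plt ?posrE ?divr_gt0// invf_div; exact: truncnS_gt.
pose S := {ffun 'I_L -> 'I_q}; pose J := (S * 'I_L)%type.
pose r := [seq p <- enum {: J} | I p.2].
have ur : uniq r by rewrite filter_uniq// enum_uniq.
have e20 : 0 < e / 2 by rewrite divr_gt0.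
have [M [ee [ee0 joint]]] := @joint_approximation R (size r) (e / 2) e20.
have [Q weyl] := @weyl_affine R D ee 1 ee0 isT.
(* [a] bounds every column sum of absolute values in every [A_ d]; rows [p *: (u *m A_ d)] with p at
   most [Q] and entries of [u] at most [M] are then bounded by [Q * M * a]. *)
pose a := (\sum_(d < D.+1) \sum_l \sum_j `|A_ d l j|%N)%N.
have [x [xV xgen]] := generic_choice (Q * (M * a)) #|S| Vinf Vgen.
pose y (s : S) := x (enum_rank s).
pose act (n : nat) (z : 'cV[R]_N) : 'cV[R]_L := \sum_(d < D.+1) n%:R ^+ d *: (map_mx intr (A_ d) *m z).
pose g (p : J) n := act n (y p.1) p.2 0 - (p.1 p.2)%:R / q%:R.
have [n gn] : exists n, forall j, j \in r -> exists z : int, `|g j n - z%:~R| < e / 2.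
  apply: joint => // m mM [[s0 l0] jr mj].
  pose u (s : S) : 'rV[int]_L := \row_l (if I l then m (s, l) else 0).
  (* Coefficients of the phase as a polynomial in [n]; the grid shifts enter only in degree 0. *)
  pose c (d : nat) := \sum_(s : S) pairing (u s *m A_ (inord d)) (y s) -
     (if d == 0%N then \sum_(p <- r) (m p)%:~R * ((p.1 p.2)%:R / q%:R) else 0).
  rewrite [X in avg_le X](_ : _ = fun n => cos1 (\sum_(i < D.+1) c i *
      (1%:R * n%:R + 0%:R) ^+ i)); last first.
    apply/funext => n; congr cos1.
    transitivity (\sum_(d < D.+1) n%:R ^+ d *
       (\sum_(s : S) pairing (u s *m A_ d) (y s)) -
       \sum_(p <- r) (m p)%:~R * ((p.1 p.2)%:R / q%:R)).
      rewrite /g; under eq_bigr do rewrite mulrBr.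
      rewrite sumrB; congr (_ - _).
      transitivity (\sum_(s : S) \sum_l (u s 0 l)%:~R * act n (y s) l 0).
        rewrite pair_bigA /= /r big_filter big_enum_cond /= big_mkcond.
        by apply: eq_bigr => -[s l] _ /=; rewrite mxE; case: ifP; rewrite ?mulr0z ?mul0r.
      under [RHS]eq_bigr do rewrite mulr_sumr.
      rewrite [RHS]exchange_big /=; apply: eq_bigr => s _.
      under [RHS]eq_bigr do rewrite pairing_act mulr_sumr.
      rewrite [RHS]exchange_big /=; apply: eq_bigr => l _.
      rewrite /act summxE mulr_sumr; apply: eq_bigr => d _.
      by rewrite [RHS]mulrCA; congr (_ * _); rewrite mxE.
    rewrite /c; under [RHS]eq_bigr do rewrite mulrBl mul1r addr0.
    rewrite sumrB; congr (_ - _).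
      by apply: eq_bigr => d _; rewrite inord_val mulrC.
    rewrite big_ord_recl /= expr0 mulr1 [X in _ + X]big1 ?addr0// => d _.
    by rewrite mul0r.
  apply: weyl.
  have us0 : u s0 != 0.
    apply: contraNneq mj => /rowP/(_ l0); rewrite !mxE.
    by move: jr; rewrite mem_filter /= => /andP[-> _] ->.
  have [l /negbTE Il|d d0 ud] := indep (u s0) _ us0; first by rewrite mxE Il.
  exists d; first by rewrite d0 -ltnS ltn_ord.
  move=> p /andP[p0 pQ]; rewrite /c (gtn_eqF d0) subr0 inord_val mulr_sumr.
  (* The rows indexed by [S] are renumbered by integers and extended by zero. *)
  pose m' (i : nat) : 'rV[int]_N := if insub i is Some i'
     then p%:Z *: (u (enum_val (i' : 'I_#|S|)) *m A_ d) else 0.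
  rewrite (_ : \sum_s _ = \sum_(i < #|S|) pairing (m' i) (x i)).
    apply: xgen.
      move=> i j; rewrite /m'; case: insubP => [i' _ _|_]; last by rewrite mxE normr0.
      rewrite !mxE normrM.
      have lea : (\sum_l `|A_ d l j|%N <= a)%N.
        rewrite /a (bigD1 d) //=; apply: leq_trans (leq_addr _ _).
        by apply: leq_sum => k _; rewrite (bigD1 j) //= leq_addr.
      rewrite PoszM; apply: ler_pM => //.
      apply: (@le_trans _ _ (\sum_l M%:Z * `|A_ d l j|)).
        apply: le_trans (ler_norm_sum _ _ _) _; apply: ler_sum => k _.
        rewrite normrM ler_wpM2r// mxE; case: ifP => // _; rewrite normr0//.
      rewrite -mulr_sumr PoszM ler_wpM2l//.
      under eq_bigr do rewrite -abszE.
      by rewrite -(big_morph Posz PoszD (erefl _)) lez_nat.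
    exists (enum_rank s0); first exact: ltn_ord.
    rewrite /m' valK enum_rankK; have /matrix0Pn[i [j uij]] := ud.
    apply/matrix0Pn; exists i, j; rewrite mxE mulf_neq0//.
    by rewrite eqz_nat -lt0n.
  rewrite [RHS](reindex (@enum_rank S)) /=; last exact/onW_bij/enum_rank_bij.
  by apply: eq_bigr => s _; rewrite /m' valK enum_rankK pairingZ.
exists n => t.
(* The grid point just below the fractional parts of [t]. *)
pose s : S := [ffun l => inord (Num.truncn (q%:R * (t l 0 - (Num.floor (t l 0))%:~R)))].
exists (y s); [exact: xV|move=> l Il].
have [|z zP] := gn (s, l).
  by rewrite mem_filter Il mem_enum.
exists (z - Num.floor (t l 0)); set f := Num.floor _.
have : `|(s l)%:R / q%:R - (t l 0 - f%:~R)| < e / 2.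
  have f0 : 0 <= t l 0 - f%:~R by rewrite subr_ge0 floor_le_tmp.
  have f1 : t l 0 - f%:~R < 1 by rewrite ltrBlDr addrC -intrD1 floorD1_gt.
  set h := t l 0 - _ in f0 f1 *.
  have sE : (s l)%:R = (Num.truncn (q%:R * h))%:R :> R.
    rewrite /s ffunE inordK// -(ltr_nat R); apply: (@le_lt_trans _ _ (q%:R * h)).
      by rewrite truncn_le ?mulr_ge0.
    by rewrite -[ltRHS]mulr1 ltr_pM2l.
  have h1 : (s l)%:R <= q%:R * h by rewrite sE truncn_le ?mulr_ge0.
  have h2 : q%:R * h < (s l)%:R + 1 by rewrite sE natr1; exact: truncnS_gt.
  apply: le_lt_trans eq2; rewrite distrC ger0_norm.
    rewrite -(ler_pM2l q0) mulrBr mulfV ?gt_eqF// mulrCA mulfV ?gt_eqF//; lra.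
  by rewrite subr_ge0 ler_pdivrMr// mulrC.
move=> le2; rewrite sub_mxE.
have -> : act n (y s) l 0 - t l 0 - (z - f)%:~R =
   (g (s, l) n - z%:~R) + ((s l)%:R / q%:R - (t l 0 - f%:~R)).
  by rewrite /g /= rmorphB /=; ring.
apply: le_lt_trans (ler_normD _ _) _; lra.
Qed.

End Generic.

(** * The torus *)

Section TorusNorm.
Variable R : realType.

Lemma norm_cV_le m (x : 'cV[R]_m) c : 0 <= c -> (forall i, `|x i 0| <= c) -> `|x| <= c.
Proof.
move=> c0 xc; rewrite [leLHS]/Num.norm /= mx_normrE; apply: bigmax_le => // -[i j] _ /=.
by rewrite ord1.
Qed.

Lemma norm_coord_le m (x : 'cV[R]_m) i : `|x i 0| <= `|x|.
Proof.
rewrite [leRHS]/Num.norm /= mx_normrE.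
exact: (le_bigmax 0 (fun ij : 'I_m * 'I_1 => `|x ij.1 ij.2|) (i, 0)).
Qed.

Lemma intvec_map m n (M : 'M[int]_(m, n)) : (map_mx intr M : 'M[R]_(m, n)) \is a mxOver Num.int.
Proof. by apply/mxOverP => i j; rewrite mxE intr_int. Qed.

Lemma intvec0 m : (0 : 'cV[R]_m) \is a mxOver Num.int.
Proof. by apply/mxOverP => i j; rewrite mxE rpred0. Qed.

Lemma intvec_lift m (z : 'cV[R]_m) : z \is a mxOver Num.int ->
  exists w : 'cV[int]_m, z = map_mx intr w.
Proof.
move=> /mxOverP zZ; exists (\col_i Num.floor (z i 0)).
by apply/colP => i; rewrite !mxE floorK.
Qed.

Lemma intvec_norm_lt1 m (z : 'cV[R]_m) : z \is a mxOver Num.int -> `|z| < 1 -> z = 0.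
Proof.
move=> /mxOverP zZ z1; apply/colP => i; rewrite mxE.
have := le_lt_trans (norm_coord_le z i) z1.
have /intrP[k ->] := zZ i 0; rewrite -intr_norm -[1]/(1%:~R) ltr_int => k1.
by have -> : k = 0 by lia.
Qed.

Definition mx_bound m n (M : 'M[int]_(m, n)) : R := (\sum_i \sum_j `|M i j|)%:~R.

Lemma mx_bound_ge0 m n (M : 'M[int]_(m, n)) : 0 <= mx_bound M.
Proof. by rewrite ler0z; do 2![apply: sumr_ge0 => ? _]. Qed.

Lemma norm_act_le m n (M : 'M[int]_(m, n)) (x : 'cV[R]_n) :
  `|map_mx intr M *m x| <= mx_bound M * `|x|.
Proof.
apply: norm_cV_le => [|i]; first by rewrite mulr_ge0 ?mx_bound_ge0.
rewrite mxE; apply: le_trans (ler_norm_sum _ _ _) _.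
apply: (@le_trans _ _ (\sum_j (`|M i j|%:~R * `|x|))).
  apply: ler_sum => j _; rewrite normrM mxE intr_norm ler_wpM2l//.
  exact: norm_coord_le.
rewrite -mulr_suml ler_wpM2r// /mx_bound -rmorph_sum ler_int.
rewrite [leRHS](bigD1 i) //= lerDl.
by do 2![apply: sumr_ge0 => ? _].
Qed.

Lemma has_inf_distZ m (x : 'cV[R]_m) :
  has_inf [set `|x - z| | z in [set z : 'cV[R]_m | z \is a mxOver Num.int]].
Proof.
split; last by exists 0 => _ [z _ <-].
by exists `|x - 0|; exists 0 => //=; exact: intvec0.
Qed.

Lemma distZ_le m (x z : 'cV[R]_m) : z \is a mxOver Num.int -> distZ x <= `|x - z|.
Proof.
by move=> zZ; apply: ge_inf; [case: (has_inf_distZ x)|exists z].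
Qed.

Lemma distZ_witness m (x : 'cV[R]_m) c : distZ x < c ->
  exists2 z : 'cV[R]_m, z \is a mxOver Num.int & `|x - z| < c.
Proof.
rewrite -subr_gt0 => c0.
have [_ [z zZ <-]] := inf_adherent c0 (has_inf_distZ x).
by rewrite -/(distZ x) [ltRHS]addrC subrK; exists z.
Qed.

Lemma torus_rep m (t : torus R m) : exists x, t = \pi_(torus R m)%qT x.
Proof. by exists (repr t); rewrite reprK. Qed.

Lemma torus_rep_small m (t : torus R m) c : torus_norm t < c ->
  exists2 x, t = \pi_(torus R m)%qT x & `|x| < c.
Proof.
have [x ->] := torus_rep t; rewrite torus_norm_pi => /distZ_witness[z zZ xz].
by exists (x - z) => //; apply/pi_torus_eq; rewrite opprB addrC subrK.
Qed.

Lemma torus_norm_le m (x : 'cV[R]_m) : torus_norm (\pi_(torus R m)%qT x) <= `|x|.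
Proof.
by rewrite torus_norm_pi -[x in leRHS]subr0; apply: distZ_le; exact: intvec0.
Qed.

Lemma torus_actB m n (M : 'M[int]_(m, n)) (s t : torus R n) :
  torus_act M (s - t) = torus_act M s - torus_act M t.
Proof.
have [x ->] := torus_rep s; have [y ->] := torus_rep t.
by rewrite -raddfB !torus_act_pi mulmxBr raddfB.
Qed.

Lemma torus_actD m n (M : 'M[int]_(m, n)) (s t : torus R n) :
  torus_act M (s + t) = torus_act M s + torus_act M t.
Proof.
have [x ->] := torus_rep s; have [y ->] := torus_rep t.
by rewrite -raddfD !torus_act_pi mulmxDr raddfD.
Qed.

Lemma torus_actM m n p (M : 'M[int]_(m, n)) (P : 'M[int]_(n, p)) (s : torus R p) :
  torus_act (M *m P) s = torus_act M (torus_act P s).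
Proof.
by have [x ->] := torus_rep s; rewrite !torus_act_pi map_mxM mulmxA.
Qed.

(* The doubling of a representative of norm less than [1/3] stays the shortest
   representative, so it could be iterated forever. *)
Lemma no_small_subgroup m (S : set (torus R m)) c : c < 3^-1 ->
  S 0 -> (forall x y, S x -> S y -> S (x - y)) ->
  (forall t, S t -> torus_norm t < c) -> S = [set 0].
Proof.
move=> c3 S0 SB Sc; apply/seteqP; split=> [t St|_ ->//] /=.
have [x Ex xc] := torus_rep_small (Sc _ St).
have iter k : S (\pi_(torus R m)%qT (x *+ (2 ^ k))) /\ `|x *+ (2 ^ k)| < c.
  elim: k => [|k [IH1 IH2]]; first by rewrite mulr1n -Ex.
  rewrite expnSr mulrnA mulr2n; set y := x *+ _ in IH1 IH2 *.
  have Sy : S (\pi_(torus R m)%qT (y + y)).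
    by rewrite raddfD /= -[X in _ + X]opprK; apply: (SB) => //; rewrite -sub0r; apply: SB.
  split=> //; have := Sc _ Sy; rewrite torus_norm_pi => /distZ_witness[z zZ yz].
  (* [|z| <= |y + y| + |y + y - z| < 3 * c < 1]. *)
  have z0 : z = 0.
    apply: intvec_norm_lt1 => //.
    have := ler_normB (y + y) (y + y - z); rewrite opprB addrC subrK.
    have := ler_normD y y; lra.
  by rewrite z0 subr0 in yz.
suff x0 : x = 0 by rewrite Ex x0 raddf0.
apply/eqP; rewrite -normr_eq0 eq_le normr_ge0 andbT leNgt; apply/negP => x0.
pose k := (Num.truncn (c / `|x|)).+1.
have [_] := iter k; rewrite normrMn -mulr_natl -ltr_pdivlMr// ltNge => /negP; apply.
apply: ltW; apply: lt_le_trans (truncnS_gt _) _.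
by rewrite ler_nat ltnW// ltn_expl.
Qed.

Lemma lipschitz_continuous (V W : normedModType R) (f : V -> W) c :
  (forall x y, `|f x - f y| <= c * `|x - y|) -> continuous f.
Proof.
move=> fc x; apply/cvgrPdist_lt => e e0.
have c0 : 0 < `|c| + 1 by rewrite ltr_wpDl.
near=> y; apply: le_lt_trans (fc x y) _.
apply: (@le_lt_trans _ _ ((`|c| + 1) * `|x - y|)).
  by rewrite ler_wpM2r//; apply: le_trans (ler_norm _) _; rewrite lerDl.
rewrite mulrC -ltr_pdivlMr//; near: y.
by apply: cvgr_dist_lt; [exact: cvg_id|rewrite divr_gt0].
Unshelve. all: end_near. Qed.

End TorusNorm.

(** * Subtori given by unimodular coordinates *)

Section CoordinateSubtorus.
Variables (R : realType) (L : nat) (U P : 'M[int]_L) (I : pred 'I_L).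
Hypotheses (UP : U *m P = 1%:M) (PU : P *m U = 1%:M).

Definition coord_subtorus : set (torus R L) :=
  [set t | exists2 v : 'cV[R]_L, (forall l, ~~ I l -> v l 0 = 0) &
     t = \pi_(torus R L)%qT (map_mx intr U *m v)].

Lemma map_mx_mulK (x : 'cV[R]_L) : map_mx intr P *m (map_mx intr U *m x) = x.
Proof. by rewrite mulmxA -map_mxM PU map_mx1 mul1mx. Qed.

Lemma map_mx_mulVK (x : 'cV[R]_L) : map_mx intr U *m (map_mx intr P *m x) = x.
Proof. by rewrite mulmxA -map_mxM UP map_mx1 mul1mx. Qed.

(** Replaces the existence of a lift by integrality of the coordinates of [P x] outside [I], which
    is visibly a closed condition and one stable under subtraction. *)
Lemma coord_subtorus_pi (x : 'cV[R]_L) :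
  coord_subtorus (\pi_(torus R L)%qT x) <->
  forall l, ~~ I l -> (map_mx intr P *m x) l 0 \is a Num.int.
Proof.
split=> [[v vI /pi_torus_eq/intvec_lift[w Ew]] l Il|xP].
  rewrite -[x](subrK (map_mx intr U *m v)) Ew mulmxDr map_mx_mulK -map_mxM.
  by rewrite mxE vI// addr0 mxE intr_int.
pose y := map_mx intr P *m x.
exists (\col_l if I l then y l 0 else 0).
  by move=> l /negbTE Il; rewrite mxE Il.
apply/pi_torus_eq; rewrite -{1}[x]map_mx_mulVK -/y -mulmxBr.
have /intvec_lift[w ->] : y - (\col_l if I l then y l 0 else 0) \is a mxOver Num.int.
  rewrite -/y in xP; clearbody y.
  apply/mxOverP => l j; rewrite ord1 !mxE.
  case: ifPn => Il; first by rewrite subrr rpred0.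
  by rewrite subr0; exact: xP.
by rewrite -map_mxM intvec_map.
Qed.

Lemma closed_coord_subtorus : closed coord_subtorus.
Proof.
rewrite -[coord_subtorus]setCK closedC /open /= /quotient_open.
rewrite -closedC.
(* In the quotient topology closedness is tested on the preimage in R^L; integrality of a coordinate
   is the vanishing of sin(pi x). *)
rewrite (_ : ~` _ = \bigcap_(l in [set l | ~~ I l])
    ((fun x : 'cV[R]_L => sin (pi * (map_mx intr P *m x) l 0)) @^-1` [set 0])).
  apply: closed_bigI => l _; apply: preimage_closed; last first.
    by apply: accessible_closed_set1; apply: hausdorff_accessible; exact: Rhausdorff.
  move=> x _; apply: continuous_comp; last exact: continuous_sin.
  apply: (@lipschitz_continuous R 'cV[R]_L R^o _ (pi * mx_bound R P)) => {}x y.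
  rewrite -mulrBr normrM (gtr0_norm (pi_gt0 R)) -mulrA ler_pM2l ?pi_gt0//.
  apply: le_trans (norm_act_le P (x - y)).
  by apply: le_trans (norm_coord_le _ l); rewrite mulmxBr sub_mxE.
apply/seteqP; split=> x /=.
  move=> /contrapT/coord_subtorus_pi xP l /xP; exact: sin_pi_int.
move=> sin0; apply; apply/coord_subtorus_pi => l Il.
apply: contrapT => /negP/sin_pi_gt0.
by rewrite (sin0 l Il) normr0 ltxx.
Qed.

(** The set is a union of continuous images of segments, all starting at 0. *)
Lemma connected_coord_subtorus : connected coord_subtorus.
Proof.
pose D := [set v : 'cV[R]_L | forall l, ~~ I l -> v l 0 = 0].
pose ray (v : 'cV[R]_L) (s : R) := \pi_(torus R L)%qT (map_mx intr U *m (s *: v)).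
rewrite (_ : coord_subtorus = \bigcup_(v in D) [set ray v s | s in `[0, 1]]).
  apply: bigcup_connected.
    exists 0 => v Dv; exists 0; first by rewrite /= in_itv /= lexx ler01.
    by rewrite /ray scale0r mulmx0 raddf0.
  move=> v Dv; apply: connected_continuous_connected; first exact: segment_connected.
  apply: continuous_subspaceT => s.
  apply: (@continuous_comp _ _ _ (fun s : R => map_mx intr U *m (s *: v))
    (\pi_(torus R L)%qT)); last exact: (@pi_continuous 'cV[R]_L (Quotient.quot (intvec (R:=R) (m:=L)))).
  apply: (@lipschitz_continuous R R^o 'cV[R]_L _ `|map_mx intr U *m v|) => {}s s'.
  by rewrite -mulmxBr -scalerBl -scalemxAr normrZ mulrC.
apply/seteqP; split=> [t [v vI ->]|_ [v Dv [s _ <-]]].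
  exists v => //; exists 1; first by rewrite /= in_itv /= lexx ler01.
  by rewrite /ray scale1r.
by exists (s *: v) => // l Il; rewrite mxE Dv// mulr0.
Qed.

Lemma coord_subtorusP : (exists l, I l) -> subtorus coord_subtorus.
Proof.
move=> [l0 Il0]; split.
- split.
    rewrite -(raddf0 (\pi_(torus R L)%qT)).
    by apply/coord_subtorus_pi => l _; rewrite mulmx0 mxE rpred0.
  move=> s t; have [x ->] := torus_rep s; have [y ->] := torus_rep t.
  rewrite -raddfB => /coord_subtorus_pi xP /coord_subtorus_pi yP.
  apply/coord_subtorus_pi => l Il; rewrite mulmxBr.
  by rewrite sub_mxE rpredB ?xP ?yP.
- exact: closed_coord_subtorus.
- exact: connected_coord_subtorus.
(* Half a basis vector of [I] gives a nonzero element, 1/2 not being an integer. *)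
pose v : 'cV[R]_L := 2^-1 *: delta_mx l0 0.
move=> S0; have : coord_subtorus (\pi_(torus R L)%qT (map_mx intr U *m v)).
  exists v => // l Il; rewrite !mxE; case: eqP => [ll0|_]; last by rewrite mulr0.
  by rewrite ll0 Il0 in Il.
rewrite S0 /= -(raddf0 (\pi_(torus R L)%qT)) => /pi_torus_eq; rewrite subr0.
move=> /intvec_lift[w /(congr1 (mulmx (map_mx intr P)))].
rewrite map_mx_mulK -map_mxM => /(congr1 (fun M : 'cV[R]_L => M l0 0)).
rewrite !mxE !eqxx mulr1 => h.
have half0 : 0 < (2^-1 : R) by rewrite invr_gt0.
have half1 : (2^-1 : R) < 1 by rewrite invf_lt1 ?ltr1n.
by move: half0 half1; rewrite h -[1]/(1%:~R) ltr_int ltr0z; lia.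
Qed.

End CoordinateSubtorus.

(** * Sufficiency *)

Section Smith.

(** The Smith normal form of a single row has one entry, and its left factor is 1 by 1. *)
Lemma primitive_row N (m : 'rV[int]_N.+1) : m != 0 ->
  exists (k : int) (P P' : 'M[int]_N.+1), [/\ k != 0, P *m P' = 1%:M, P' *m P = 1%:M
    & m = k *: (delta_mx 0 0 *m P)].
Proof.
move=> m0; have [U _ [P Punit [d _ Em]]] := int_Smith_normal_form m.
exists (U 0 0 * d`_0), P, (invmx P); split; rewrite ?mulmxV ?mulVmx//.
  apply: contraNneq m0 => k0; apply/eqP; rewrite Em.
  suff -> : U *m (\matrix_(i, j) (d`_i *+ (i == j :> nat))) = 0 :> 'rV_N.+1 by rewrite mul0mx.
  apply/rowP => j; rewrite !mxE big_ord1 !mxE /=.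
  by case: (0%N == j); rewrite ?mulr1n ?mulr0n ?mulr0.
rewrite {1}Em scalemxAl; congr (_ *m _); apply/rowP => j.
rewrite !mxE big_ord1 !mxE -mulrA mulr_natr eqxx; congr (_ * (_ *+ _)).
by rewrite eq_sym.
Qed.

(* A unimodular change of coordinates of [Z^L] splits off the common left kernel
   of the [A_ d], [d > 0]: it is spanned by the rows of [P] outside [I]. *)
Lemma left_kernel_split (L N D : nat) (A_ : 'I_D.+1 -> 'M[int]_(L, N)) :
  exists (U P : 'M[int]_L) (I : pred 'I_L), [/\ U *m P = 1%:M, P *m U = 1%:M,
    forall l, ~~ I l -> forall d : 'I_D.+1, (0 < d)%N -> row l (P *m A_ d) = 0
  & forall u : 'rV[int]_L, (forall l, ~~ I l -> u 0 l = 0) -> u != 0 ->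
    exists2 d : 'I_D.+1, (0 < d)%N & u *m (P *m A_ d) != 0].
Proof.
pose J := ('I_D * 'I_N)%type.
(* The matrices [A_ d] with d > 0 side by side, so that the left kernel of [C] is their common left
   kernel. *)
pose C : 'M[int]_(L, #|{: J}|) :=
  \matrix_(l, j) A_ (lift ord0 (enum_val j).1) l (enum_val j).2.
have [U Uunit [V Vunit [s _ EC]]] := int_Smith_normal_form C.
pose E : 'M[int]_(L, #|{: J}|) := \matrix_(i, j) (s`_i *+ (i == j :> nat)).
have PC : invmx U *m C = E *m V by rewrite EC -mulmxA mulKmx.
have colE (u : 'rV[int]_L) (d : 'I_D) k :
    (u *m C) 0 (enum_rank (d, k)) = (u *m A_ (lift ord0 d)) 0 k.
  by rewrite !mxE; apply: eq_bigr => l _; rewrite !mxE enum_rankK.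
(* [I] consists of the rows with a nonzero entry in the Smith form of [C]. *)
exists U, (invmx U), [pred l : 'I_L | (l < #|{: J}|)%N && (s`_l != 0)].
split; rewrite ?mulmxV ?mulVmx//.
  move=> l Il d; case: (unliftP ord0 d) => [d' -> _|->//]; apply/rowP => k.
  rewrite row_mul -colE -row_mul PC row_mul (_ : row l E = 0) ?mul0mx ?mxE//.
  apply/rowP => j; rewrite !mxE; case: eqP => [lj|//].
  by move: Il; rewrite /= lj ltn_ord /= negbK -lj => /eqP ->.
move=> u uI u0; apply: contrapT => /forall2NP nod.
have uC : u *m invmx U *m C = 0.
  apply/rowP => j; rewrite -(enum_valK j); case: (enum_val j) => d k.
  rewrite colE; have [//|] := nod (lift ord0 d).
  by move=> /negP; rewrite negbK -mulmxA => /eqP ->; rewrite !mxE.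
have uE : u *m E = 0.
  by rewrite -[E](mulmxK Vunit) -PC !mulmxA uC mul0mx.
move/eqP: u0; apply; apply/rowP => l; rewrite mxE.
have [Il|/uI//] := boolP ((l < #|{: J}|)%N && (s`_l != 0)).
have /andP[lJ sl] := Il.
have := congr1 (fun M : 'rV[int]_ _ => M 0 (Ordinal lJ)) uE.
rewrite !mxE (bigD1 l) //= big1 ?addr0; last first.
  move=> i il; rewrite mxE /= (_ : (i == l :> nat) = false) ?mulr0//.
  exact: negbTE.
by rewrite mxE eqxx mulr1n => /eqP; rewrite mulf_eq0 (negbTE sl) orbF => /eqP.
Qed.

End Smith.

(** * Generic sets, reduction to cosets, and the induction on the dimension *)

Section Density.
Variable R : realType.

Definition poly_mx (L N D : nat) (A_ : 'I_D.+1 -> 'M[int]_(L, N)) (n : int) : 'M[int]_(L, N) :=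
  \sum_(d < D.+1) n ^+ d *: A_ d.

Lemma mulmx_poly_mx L N D K (B : 'M[int]_(K, L)) (A_ : 'I_D.+1 -> 'M[int]_(L, N)) n :
  B *m poly_mx A_ n = poly_mx (fun d => B *m A_ d) n.
Proof. by rewrite mulmx_sumr; apply: eq_bigr => d _; rewrite -scalemxAr. Qed.

Lemma poly_mx_mulmx L N D K (A_ : 'I_D.+1 -> 'M[int]_(L, N)) (B : 'M[int]_(N, K)) n :
  poly_mx A_ n *m B = poly_mx (fun d => A_ d *m B) n.
Proof. by rewrite mulmx_suml; apply: eq_bigr => d _; rewrite -scalemxAl. Qed.

Lemma poly_mx_act L N D (A_ : 'I_D.+1 -> 'M[int]_(L, N)) (n : nat) (x : 'cV[R]_N) :
  map_mx intr (poly_mx A_ n) *m x = \sum_(d < D.+1) n%:R ^+ d *: (map_mx intr (A_ d) *m x).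
Proof.
rewrite /poly_mx raddf_sum mulmx_suml; apply: eq_bigr => d _ /=.
by rewrite map_mxZ rmorphXn /= -scalemxAl.
Qed.

(* The integral form of conditions (a) and (b). *)
Definition glasner_cond (L N D : nat) (A_ : 'I_D.+1 -> 'M[int]_(L, N)) :=
  (forall w : 'cV[int]_N, (forall d : 'I_D.+1, (0 < d)%N -> A_ d *m w = 0) -> w = 0) /\
  (forall (v : 'rV[int]_L) (w : 'cV[int]_N),
    (forall d : 'I_D.+1, (0 < d)%N -> v *m (A_ d *m w) = 0) -> v *m (A_ ord0 *m w) = 0).

Definition glasner (L N D : nat) (A_ : 'I_D.+1 -> 'M[int]_(L, N)) (X : set (torus R N)) :=
  exists2 T : set (torus R L), subtorus T & forall e : R, 0 < e ->
    exists n : int, exists a : torus R L,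
      eps_dense e (torus_act (poly_mx A_ n) @` X) (translate a T).

Lemma infinite_reprs N (X : set (torus R N)) : infinite_set X -> infinite_set (repr @` X).
Proof.
apply: contra_not => fX.
rewrite (_ : X = \pi_(torus R N)%qT @` (repr @` X)); first exact: finite_image.
apply/seteqP; split=> [x Xx|_ [_ [x Xx <-] <-]]; last by rewrite reprK.
by exists (repr x); [exists x|rewrite reprK].
Qed.

Lemma glasner_generic (L N D : nat) (A_ : 'I_D.+1 -> 'M[int]_(L, N.+1))
    (X : set (torus R N.+1)) :
  glasner_cond A_ -> infinite_set X -> generic (repr @` X) -> glasner A_ X.
Proof.
move=> [condA condB] Xinf Xgen.
have [U [P [I [UP PU rowI indep]]]] := left_kernel_split A_.
(* Condition (b), tested on basis vectors, extends the vanishing of these rows to the constant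
   term. *)
have rowA l : ~~ I l -> forall d, row l (P *m A_ d) = 0.
  move=> Il d; case: (posnP d) => [d0|d0]; last exact: rowI.
  have -> : d = ord0 by apply: val_inj.
  apply/rowP => k.
  have /matrixP/(_ 0 0) : row l P *m (A_ ord0 *m (delta_mx k 0 : 'cV[int]_N.+1)) = 0.
    by apply: condB => d' d'0; rewrite mulmxA -row_mul rowI// mul0mx.
  by rewrite mulmxA -row_mul -colE mxE [X in _ = X -> _]mxE => ->; rewrite mxE.
(* With [I] empty all the [A_ d] vanish, against (a); hence the subtorus is non-trivial. *)
have exI : exists l, I l.
  apply: contrapT => /forallNP noI.
  have w0 : delta_mx 0 0 = 0 :> 'cV[int]_N.+1.
    apply: condA => d d0; suff -> : A_ d = 0 by rewrite mul0mx.
    rewrite -[A_ d]mul1mx -UP -mulmxA; suff -> : P *m A_ d = 0 by rewrite mulmx0.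
    by apply/row_matrixP => l; rewrite rowA ?row0//; exact/negP/noI.
  by move/colP: w0 => /(_ 0); rewrite !mxE !eqxx.
exists (@coord_subtorus R L U I); first exact: (@coord_subtorusP R L U P I UP PU).
(* Applying [U] expands distances by at most [b], so density is requested at scale [e / b]. *)
move=> e e0; pose b := mx_bound R U + 1.
have b0 : 0 < b by rewrite ltr_wpDl ?mx_bound_ge0.
have eb0 : 0 < e / b by rewrite divr_gt0.
have [n hn] := generic_dense (infinite_reprs Xinf) Xgen eb0 indep.
exists n%:Z, 0; move=> _ [_ [v vI ->] <-]; rewrite add0r.
have [_ [x Xx <-] xP] := hn v.
pose g := map_mx intr (P *m poly_mx A_ n) *m repr x.
have gE : g = \sum_(d < D.+1) n%:R ^+ d *: (map_mx intr (P *m A_ d) *m repr x).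
  by rewrite /g mulmx_poly_mx poly_mx_act.
(* The coordinates outside [I] vanish exactly, so the image lies in the subtorus itself and the
   translate by 0 suffices. *)
have gI l : ~~ I l -> g l 0 = 0.
  move=> Il; rewrite gE summxE big1// => d _.
  rewrite mxE (_ : (map_mx intr (P *m A_ d) *m repr x) l 0 =
      (row l (map_mx intr (P *m A_ d)) *m repr x) 0 0); last by rewrite -row_mul [RHS]mxE.
  by rewrite -map_row rowA// map_mx0 mul0mx mxE mulr0.
have actE : torus_act (poly_mx A_ n) x = \pi_(torus R L)%qT (map_mx intr U *m g).
  by rewrite /torus_act /g map_mxM -mulmxA map_mx_mulVK.
exists (torus_act (poly_mx A_ n) x).
  split; first by exists x.
  by rewrite actE; exists (\pi_(torus R L)%qT (map_mx intr U *m g)); [exists g|rewrite add0r].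
have /choice[z hz] : forall l, exists z : int, `|(g - v) l 0 - z%:~R| < e / b.
  move=> l; have [Il|Il] := boolP (I l); first by rewrite gE; exact: xP.
  by exists 0; rewrite sub_mxE gI// vI// !subr0 normr0.
rewrite actE -raddfB -mulmxBr torus_norm_pi.
apply: (@le_trans _ _ `|map_mx intr U *m (g - v - map_mx intr (\col_l z l))|).
  rewrite [X in _ <= `|X|]mulmxBr; apply: distZ_le.
  by rewrite -map_mxM intvec_map.
apply: le_trans (norm_act_le _ _) _.
apply: (@le_trans _ _ (b * (e / b))); last by rewrite mulrCA divff ?mulr1 ?gt_eqF.
apply: ler_pM; rewrite ?mx_bound_ge0//; first by rewrite lerDl.
apply: norm_cV_le => [|l]; first exact: ltW.
rewrite (sub_mxE (g - v)) (_ : map_mx intr (\col_l z l) l 0 = (z l)%:~R).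
  exact/ltW/hz.
by rewrite !mxE.
Qed.

(** If m.x is [c] mod 1 infinitely often and [m] is [k] times a row of a unimodular matrix, that row
    takes one of the |k| values (c + r) / k mod 1 infinitely often by pigeonhole; the remaining
    coordinates parametrize the coset. *)
Lemma coset_reduction N (X : set (torus R N.+1)) : ~ generic (repr @` X) ->
  exists (x0 : torus R N.+1) (B : 'M[int]_(N.+1, N)) (Y : set (torus R N)),
  [/\ forall w : 'cV[int]_N, B *m w = 0 -> w = 0, infinite_set Y &
      forall y, Y y -> X (x0 + torus_act B y)].
Proof.
move=> /existsNP[m /not_implyP[m0 /existsNP[c cinf]]].
have [k [P [P' [k0 PP' P'P Em]]]] := primitive_row m0.
have pairE x : pairing m x = k%:~R * (map_mx intr P *m x) 0 0 :> R.
  rewrite Em pairingZ; congr (_ * _).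
  rewrite pairing_act (bigD1 0)//= big1 ?addr0 ?mxE ?eqxx ?mul1r//.
  by move=> i i0; rewrite mxE (negbTE i0) andbF mul0r.
have kR0 : k%:~R != 0 :> R by rewrite intr_eq0.
pose W r : set 'cV[R]_N.+1 := (repr @` X) `&`
  [set x | (map_mx intr P *m x) 0 0 - (c + r%:R) / k%:~R \is a Num.int].
have [r Winf] : exists r : nat, infinite_set (W r).
  apply: contrapT => /forallNP Wfin; apply: cinf.
  apply: (@sub_finite_set _ _ (\bigcup_(r in `I_(`|k|%N)) W r)); last first.
    by apply: bigcup_finite; [exact: finite_II|move=> r _; apply: contrapT; exact: Wfin].
  move=> x [Xx /= /intrP[z]]; rewrite pairE => Ez.
  have mod0 : (0 <= (z %% k)%Z) by rewrite modz_ge0.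
  have [r Er] : exists r : nat, (z %% k)%Z = r by exists `|(z %% k)%Z|%N; rewrite gez0_abs.
  exists r; first by rewrite /= -ltz_nat -Er ltz_mod.
  split=> //=; apply/intrP; exists (z %/ k)%Z.
  have Ec : k%:~R * (map_mx intr P *m x) 0 0 = c + (z %/ k)%Z%:~R * k%:~R + r%:R.
    apply/eqP; rewrite -subr_eq0 -[X in X - _](subrK c) Ez {1}(divz_eq z k) Er.
    by rewrite rmorphD rmorphM /=; apply/eqP; ring.
  by apply: (mulfI kR0); rewrite mulrBr Ec; field.
set c' := (c + r%:R) / k%:~R in W Winf.
(* [x0] realizes the fixed first coordinate, and [B] embeds the other [N] coordinates. *)
pose x0 : 'cV[R]_N.+1 := map_mx intr P' *m (c' *: delta_mx 0 0).
pose low0 : 'M[int]_(1 + N, N) := col_mx 0 1%:M.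
pose B : 'M[int]_(N.+1, N) := P' *m low0.
pose low (x : 'cV[R]_N.+1) : 'cV[R]_N := dsubmx (map_mx intr P *m x : 'cV_(1 + N)).
have lowE x : W r x -> \pi_(torus R N.+1)%qT x =
    \pi_(torus R N.+1)%qT x0 + torus_act B (\pi_(torus R N)%qT (low x)).
  move=> [_ /= xZ]; rewrite torus_act_pi -raddfD; apply/pi_torus_eq.
  set y := map_mx intr P *m x in xZ.
  have Ex : x = map_mx intr P' *m y by rewrite mulmxA -map_mxM P'P map_mx1 mul1mx.
  rewrite /B map_mxM -mulmxA {1}Ex -mulmxDr -mulmxBr.
  suff /intvec_lift[w ->] : y - (c' *: delta_mx 0 0 + map_mx intr low0 *m low x)
      \is a mxOver Num.int by rewrite -map_mxM intvec_map.
  have lowcol : (map_mx intr low0 : 'M[R]_(1 + N, N)) *m low x = col_mx 0 (low x).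
    by rewrite /low0 map_col_mx mul_col_mx map_mx0 map_mx1 mul0mx mul1mx.
  apply/mxOverP => i j; rewrite ord1 sub_mxE.
  rewrite (_ : (c' *: delta_mx 0 0 + _) i 0 = c' *+ (i == 0) + (col_mx 0 (low x) : 'cV_(1 + N)) i 0); last first.
    rewrite mxE; congr (_ + _); last by rewrite -lowcol.
    by rewrite !mxE eqxx andbT mulr_natr.
  case: (split_ordP (i : 'I_(1 + N))) => i' Ei; rewrite Ei.
    rewrite col_mxEu [X in _ - (_ + X)]mxE addr0 ord1 (_ : lshift N 0 = 0); last exact: val_inj.
    by rewrite eqxx mulr1n.
  by rewrite col_mxEd /low [X in _ - (_ + X)]mxE mulr0n add0r subrr rpred0.
exists (\pi_(torus R N.+1)%qT x0), B, ((\pi_(torus R N)%qT \o low) @` W r); split.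
- move=> w /(congr1 (mulmx P)); rewrite /B !mulmxA PP' mul1mx mulmx0 => Ew.
  have lowcol : (low0 : 'M[int]_(1 + N, N)) *m w = col_mx 0 w.
    by rewrite /low0 mul_col_mx mul0mx mul1mx.
  have := congr1 (fun M : 'cV_(1 + N) => dsubmx M) (etrans (esym lowcol) Ew).
  by rewrite col_mxKd linear0.
- move=> Yfin; apply: Winf; pose h y := \pi_(torus R N.+1)%qT x0 + torus_act B y.
  apply: (@sub_finite_set _ _ (repr @` (h @` ((\pi_(torus R N)%qT \o low) @` W r)))).
    move=> x Wx; have [[t Xt Et] _] := Wx.
    exists (h (\pi_(torus R N)%qT (low x))); first by exists (\pi_(torus R N)%qT (low x)) => //; exists x.
    by rewrite /h -lowE// -Et reprK.
  by do 2!apply: finite_image.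
- by move=> _ [x Wx <-] /=; rewrite -lowE//; have [[t Xt <-] _] := Wx; rewrite reprK.
Qed.

Lemma glasner_of_cond (L N D : nat) (A_ : 'I_D.+1 -> 'M[int]_(L, N)) (X : set (torus R N)) :
  glasner_cond A_ -> infinite_set X -> glasner A_ X.
Proof.
elim: N A_ X => [|N IH] A_ X condA Xinf.
  (* T^0 is a single point. *)
  exfalso; apply: Xinf; apply: sub_finite_set (finite_set1 0) => x _ /=.
  by rewrite -[x]reprK (flatmx0 (repr x)) raddf0.
have [Xgen|/coset_reduction[x0 [B [Y [Binj Yinf YX]]]]] := pselect (generic (repr @` X)).
  exact: glasner_generic.
(* For the [A_ d *m B], condition (a) follows from the injectivity of [B], and (b) from applying the
   original one to [B *m w]. *)
have [|T Tsub Tdense] := IH (fun d => A_ d *m B) Y _ Yinf.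
  case: condA => condA condB; split=> [w Aw|v w vw].
    by apply/Binj/condA => d d0; rewrite mulmxA Aw.
  by rewrite -mulmxA; apply: condB => d d0; have := vw d d0; rewrite -mulmxA.
exists T => // e /Tdense[n [a dense]].
(* The base point [x0] of the coset only translates the image, by A(n) x0. *)
exists n, (torus_act (poly_mx A_ n) x0 + a); move=> _ [s Ts <-].
have [_ [[y Yy <-] [s' Ts' Es']] le] := dense (a + s) (ex_intro2 _ _ s Ts erefl).
have actE : torus_act (poly_mx A_ n) (x0 + torus_act B y) =
    torus_act (poly_mx A_ n) x0 + torus_act (poly_mx (fun d => A_ d *m B) n) y.
  by rewrite -poly_mx_mulmx torus_actM torus_actD.
exists (torus_act (poly_mx A_ n) (x0 + torus_act B y)).
  split; first by exists (x0 + torus_act B y) => //; exact: YX.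
  by exists s' => //; rewrite actE -Es' addrA.
by rewrite actE -(addrA _ a s) opprD addrACA subrr add0r.
Qed.

End Density.

(** * Necessity *)

Section Necessity.
Variable R : realType.

Lemma infinite_range (T : Type) (f : nat -> T) : injective f -> infinite_set (range f).
Proof.
move=> finj ffin; apply: infinite_nat.
pose g t := xget 0%N [set k | f k = t].
apply: (@sub_finite_set _ _ (g @` range f)); last exact: finite_image.
move=> k _; exists (f k); first by exists k.
by apply: finj; rewrite /g; case: xgetP => [k' _ //|/(_ k) /= []].
Qed.

Lemma divr_succ_itv (s : R) i : 0 < s -> 0 <= s / i.+1%:R <= s.
Proof.
move=> /ltW s0; rewrite divr_ge0//= ler_pdivrMr// ler_peMr// ler1n//.
Qed.

Lemma divr_succ_dist (s : R) j k : 0 < s -> `|s / j.+1%:R - s / k.+1%:R| <= s.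
Proof.
move=> s0; move: (divr_succ_itv j s0) (divr_succ_itv k s0).
move: (s / j.+1%:R) (s / k.+1%:R) => x y /andP[x0 xs] /andP[y0 ys].
by rewrite ler_norml; apply/andP; split; lra.
Qed.

(** Differences of these vectors have norm below 1, so points equal mod 1 are equal. *)
Lemma harmonic_range_infinite N (w : 'cV[R]_N) (s : R) : w != 0 -> 0 < s -> s * `|w| < 1 ->
  infinite_set (range (fun k => \pi_(torus R N)%qT ((s / k.+1%:R) *: w))).
Proof.
move=> w0 s0 sw; apply: infinite_range => j k /pi_torus_eq.
rewrite -scalerBl => /intvec_norm_lt1 h.
have /eqP : (s / j.+1%:R - s / k.+1%:R) *: w = 0.
  apply: h; rewrite normrZ; apply: le_lt_trans sw; rewrite ler_wpM2r//.
  exact: divr_succ_dist.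
rewrite scaler_eq0 (negbTE w0) orbF subr_eq0 => /eqP /(mulfI (lt0r_neq0 s0)).
by move=> /invr_inj/eqP; rewrite eqr_nat => /eqP[].
Qed.

(** Points of [Y] near a + 0 and a + t are subtracted. Each has a representative error below 2 e,
    twice the bound [e] to gain strictness. *)
Lemma eps_dense_diff L (e : R) (Y T : set (torus R L)) a t :
  0 < e -> eps_dense e Y (translate a T) -> T 0 -> T t ->
  exists y y' u, [/\ (Y `&` translate a T) y, (Y `&` translate a T) y',
    t = y' - y + \pi_(torus R L)%qT u & `|u| < 4 * e].
Proof.
move=> e0 dense T0 Tt.
have e2 : e < 2 * e by lra.
have [y Yy /le_lt_trans/(_ e2)] := dense (a + 0) (ex_intro2 _ _ 0 T0 erefl).
move=> /torus_rep_small[u1 E1 u1e].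
have [y' Yy' /le_lt_trans/(_ e2)] := dense (a + t) (ex_intro2 _ _ t Tt erefl).
move=> /torus_rep_small[u2 E2 u2e].
exists y, y', (u1 - u2); split=> //; last by have := ler_normB u1 u2; lra.
by rewrite raddfB /= -E1 -E2 addr0 opprB -[a + t - y']addrA !subrKA [RHS]addrC subrK.
Qed.

(** An element of [M T] is a difference of two points of size at most 1/16 plus the image under [M]
    of a small error; all of [M T] is then within 1/4 of 0, and a subgroup this small is trivial. *)
Lemma small_image K L (M : 'M[int]_(K, L)) (Y : int -> set (torus R L)) (T : set (torus R L)) :
  T 0 -> (forall x y, T x -> T y -> T (x - y)) ->
  (forall e : R, 0 < e -> exists n a, eps_dense e (Y n) (translate a T)) ->
  (forall n y, Y n y -> exists2 x, torus_act M y = \pi_(torus R K)%qT x & `|x| <= 16^-1) ->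
  forall t, T t -> torus_act M t = 0.
Proof.
move=> T0 TB dense small t Tt.
have act0 : torus_act M 0 = 0 :> torus R K.
  by have := torus_actB M 0 (0 : torus R L); rewrite !subrr.
suff : torus_act M @` T = [set 0] by move=> /seteqP[+ _]; apply; exists t.
apply: (@no_small_subgroup _ _ _ 4^-1); first lra.
- by exists 0.
- move=> _ _ [x Tx <-] [y Ty <-]; exists (x - y); [exact: TB|exact: torus_actB].
move=> _ [{Tt}t Tt <-]; pose b := mx_bound R M + 1.
have b0 : 0 < b by rewrite ltr_wpDl ?mx_bound_ge0.
(* Makes [b * (4 * e)] equal to 1/16. *)
pose e := (64 * b)^-1; have e0 : 0 < e by rewrite invr_gt0 mulr_gt0.
have [n [a dna]] := dense e e0.
have [y [y' [u [[Yy _] [Yy' _] -> ue]]]] := eps_dense_diff e0 dna T0 Tt.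
have [x Ex xs] := small n y Yy; have [x' Ex' xs'] := small n y' Yy'.
rewrite torus_actD torus_actB Ex Ex' torus_act_pi -raddfB -raddfD.
apply: le_lt_trans (torus_norm_le _) _.
have : `|map_mx intr M *m u| <= 16^-1.
  apply: le_trans (norm_act_le _ _) _.
  apply: (@le_trans _ _ (b * (4 * e))).
    by apply: ler_pM; rewrite ?mx_bound_ge0 ?lerDl//; exact: ltW.
  by rewrite /e invfM [b * _]mulrC -!mulrA mulVf ?gt_eqF//; lra.
have := ler_normD (x' - x) (map_mx intr M *m u).
have := ler_normB x' x; lra.
Qed.

Variables (L N D : nat) (A_ : 'I_D.+1 -> 'M[int]_(L, N)).
Hypothesis glasnerA : forall X : set (torus R N), infinite_set X -> glasner A_ X.

Lemma poly_mx_vanish K (v : 'M[int]_(K, L)) (w : 'cV[int]_N) n :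
  (forall d : 'I_D.+1, (0 < d)%N -> v *m (A_ d *m w) = 0) ->
  v *m (poly_mx A_ n *m w) = v *m (A_ ord0 *m w).
Proof.
move=> vw; rewrite poly_mx_mulmx mulmx_poly_mx /poly_mx big_ord_recl expr0 scale1r.
by rewrite big1 ?addr0// => d _; rewrite vw// scaler0.
Qed.

(* [A(n) X] meets each translate of [T] in at most one point as soon as the values
   [s / (k + 1) * (v A_0 w)] of the constant character [v] on it are distinct mod 1. *)
Lemma glasner_necessary : glasner_cond A_.
Proof.
have main K (v : 'M[int]_(K, L)) (w : 'cV[int]_N) : w != 0 ->
    (forall d : 'I_D.+1, (0 < d)%N -> v *m (A_ d *m w) = 0) ->
    exists (T : set (torus R L)) s, [/\ subtorus T, 0 < s,
      s * `|map_mx intr (v *m (A_ ord0 *m w)) : 'cV[R]_K| < 1,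
      forall t, T t -> torus_act v t = 0 &
      forall e : R, 0 < e -> exists n a, eps_dense e (torus_act (poly_mx A_ n) @`
        range (fun k => \pi_(torus R N)%qT ((s / k.+1%:R) *: map_mx intr w))) (translate a T)].
  move=> w0 vw; set C := map_mx intr _; pose wR : 'cV[R]_N := map_mx intr w.
  (* Small enough that both [s * |wR|] and [s * |C|] are at most 1/16. *)
  pose s := (16 * (`|wR| + `|C| + 1))^-1.
  have s16 : s * (`|wR| + `|C| + 1) = 16^-1.
    by rewrite /s invfM -mulrA mulVf ?mulr1// gt_eqF// ltr_wpDl// addr_ge0.
  have s0 : 0 < s by rewrite invr_gt0 mulr_gt0// ltr_wpDl// addr_ge0.
  have sC : s * `|C| <= 16^-1.
    by rewrite -s16 ler_pM2l// -addrA addrCA lerDl addr_ge0.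
  have sw : s * `|wR| <= 16^-1.
    by rewrite -s16 ler_pM2l// -addrA lerDl addr_ge0.
  have wR0 : wR != 0.
    apply: contraNneq w0 => wR0; apply/eqP/colP => i; apply/eqP.
    by have /colP/(_ i) := wR0; rewrite !mxE => /eqP; rewrite intr_eq0.
  have sw1 : s * `|wR| < 1 by apply: le_lt_trans sw _; lra.
  have Xinf := harmonic_range_infinite wR0 s0 sw1.
  have [T Tsub dense] := glasnerA Xinf.
  exists T, s; split=> //; first by apply: le_lt_trans sC _; lra.
  have [[T0 TB] _ _ _] := Tsub.
  apply: small_image T0 TB dense _ => n _ [_ [k _ <-] <-].
  exists ((s / k.+1%:R) *: C).
    rewrite -torus_actM torus_act_pi -scalemxAr -map_mxM -mulmxA.
    by rewrite poly_mx_vanish.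
  apply: le_trans sC; rewrite normrZ ler_wpM2r// ger0_norm.
    by have /andP[] := divr_succ_itv k s0.
  by have /andP[] := divr_succ_itv k s0.
have nontrivial (T : set (torus R L)) : subtorus T -> ~ (forall t, T t -> t = 0).
  move=> [[T0 _] _ _ +] Tt; apply; apply/seteqP.
  by split=> [t /Tt ->|_ ->].
split=> [w Aw|v w vw].
  apply: contrapT => /eqP w0.
  (* For (a) the identity serves as [v]: then [v T = 0] says that [T] itself is trivial. *)
  have vw (d : 'I_D.+1) : (0 < d)%N -> 1%:M *m (A_ d *m w) = 0 :> 'cV[int]_L.
    by move=> d0; rewrite Aw ?mulmx0.
  have [T [s [Tsub _ _ T0 _]]] := main L 1%:M w w0 vw.
  apply: (nontrivial T Tsub) => t Tt; have := T0 t Tt.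
  by have [x ->] := torus_rep t; rewrite torus_act_pi map_mx1 mul1mx.
apply: contrapT => /eqP C0.
have w0 : w != 0 by apply: contraNneq C0 => ->; rewrite !mulmx0.
have [T [s [Tsub s0 sC T0 dense]]] := main 1%N v w w0 vw.
apply: (nontrivial T Tsub).
have [[T00 TB] _ _ _] := Tsub.
suff : T = [set 0] by move=> -> t.
apply: (@no_small_subgroup _ _ _ 4^-1) => //; first lra.
move=> t Tt; have e0 : 0 < 16^-1 :> R by rewrite invr_gt0.
have [n [a dna]] := dense _ e0.
have [y [y' [u [[Yy [b Tb Eb]] [Yy' [b' Tb' Eb']] Et ue]]]] := eps_dense_diff e0 dna T00 Tt.
(* Then [t] is the class of [u] alone, of norm below 4/16. *)
suff E : y' = y.
  rewrite Et E subrr add0r; apply: le_lt_trans (torus_norm_le _) _.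
  by apply: lt_le_trans ue _; lra.
(* Both points lie in one translate of [T], on which [v] is constant. *)
have : torus_act v y = torus_act v y'.
  by rewrite -Eb -Eb' !torus_actD (T0 _ Tb) (T0 _ Tb').
move: Yy Yy' => [_ [k _ <-] <-] [_ [k' _ <-] <-].
set C := map_mx intr _ in sC.
rewrite -!torus_actM !torus_act_pi -!scalemxAr -!map_mxM -!mulmxA.
rewrite poly_mx_vanish// => /pi_torus_eq; rewrite -scalerBl -/C => /intvec_norm_lt1 h.
have CR0 : C != 0.
  apply: contraNneq C0 => CR0; apply/eqP/colP => i; apply/eqP.
  by have /colP/(_ i) := CR0; rewrite !mxE => /eqP; rewrite intr_eq0.
have /eqP : (s / k.+1%:R - s / k'.+1%:R) *: C = 0.
  apply: h; rewrite normrZ; apply: le_lt_trans sC; rewrite ler_wpM2r//.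
  exact: divr_succ_dist.
by rewrite scaler_eq0 (negbTE CR0) orbF subr_eq0 => /eqP ->.
Qed.

End Necessity.

(** * From rational to integral conditions *)

Section Arithmetic.

Lemma common_denominator (I : finType) (c : I -> rat) :
  exists (q : int) (w : I -> int), q != 0 /\ forall i, q%:~R * c i = (w i)%:~R.
Proof.
exists (\prod_i denq (c i)), (fun i => numq (c i) * \prod_(j | j != i) denq (c j)).
split=> [|i]; first by apply/prodf_neq0 => i _; exact: denq_neq0.
by rewrite (bigD1 i) //= !rmorphM /= mulrAC [X in X * _]mulrC numqE.
Qed.

Lemma common_denominator_cV n (c : 'cV[rat]_n) :
  exists (q : int) (w : 'cV[int]_n), q != 0 /\ q%:~R *: c = map_mx intr w.
Proof.
have [q [w [q0 qw]]] := common_denominator (fun i => c i 0).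
exists q, (\col_i w i); split=> //.
by apply/colP => i; rewrite !mxE qw.
Qed.

Lemma dotvE L (u v : 'cV[rat]_L) : dotv u v = (u^T *m v) 0 0.
Proof. by rewrite mxE; apply: eq_bigr => i _; rewrite mxE. Qed.

Lemma dotv_int L N (M : 'M[int]_(L, N)) (v : 'cV[int]_L) (w : 'cV[int]_N) :
  dotv (map_mx intr v) (map_mx intr M *m map_mx intr w) = ((v^T *m (M *m w)) 0 0)%:~R.
Proof. by rewrite dotvE map_trmx -!map_mxM mxE. Qed.

Variables (L N D : nat) (A_ : 'I_D.+1 -> 'M[int]_(L, N)).
Let A : 'M[{poly int}]_(L, N) := \sum_(d < D.+1) 'X^d *: map_mx polyC (A_ d).

Lemma eval_mxE n : eval_mx A n = poly_mx A_ n.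
Proof.
apply/matrixP => i j; rewrite /A /poly_mx mxE !summxE horner_sum.
by apply: eq_bigr => d _; rewrite !mxE !hornerE.
Qed.

Lemma coef_Astar i j k : ((A - map_mx polyC (A_ ord0)) i j)`_k =
  \sum_(d < D) (A_ (lift ord0 d) i j) *+ (k == d.+1).
Proof.
rewrite /A big_ord_recl expr0 scale1r addrC addKr summxE coef_sum.
by apply: eq_bigr => d _; rewrite !mxE mulrC coefCM coefXn mulr_natr.
Qed.

Lemma coef_Astar_lift i j (d : 'I_D) :
  ((A - map_mx polyC (A_ ord0)) i j)`_d.+1 = A_ (lift ord0 d) i j.
Proof.
rewrite coef_Astar (bigD1 d) //= eqxx mulr1n big1 ?addr0// => d' d'd.
by rewrite eqSS eq_sym (negbTE (d'd : (d' != d :> nat))) mulr0n.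
Qed.

Lemma coef_col_Astar (c : rat) i j k :
  ((c%:P *: col j (map_mx (map_poly intr) (A - map_mx polyC (A_ ord0)))) i 0)`_k =
  c * (((A - map_mx polyC (A_ ord0)) i j)`_k)%:~R.
Proof.
move: (A - _) => B; rewrite mxE coefCM; congr (_ * _).
by rewrite !mxE coef_map.
Qed.

(** Comparing coefficients of x^d turns a relation between columns into A_d w = 0 for d > 0;
    clearing denominators makes [w] integral. *)
Lemma cols_Q_freeP :
  cols_Q_free (map_mx (map_poly intr) (A - map_mx polyC (A_ ord0))) <->
  (forall w : 'cV[int]_N, (forall d : 'I_D.+1, (0 < d)%N -> A_ d *m w = 0) -> w = 0).
Proof.
split=> [free w Aw|free c sumc].
  have w0 : forall j, (w j 0)%:~R = 0 :> rat.
    apply: free; apply/colP => i; rewrite summxE mxE; apply/polyP => k.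
    rewrite coef_sum coef0 /=.
    transitivity ((\sum_(d < D) (A_ (lift ord0 d) *m w) i 0 *+ (k == d.+1))%:~R : rat).
      rewrite rmorph_sum /=.
      under [RHS]eq_bigr do rewrite mxE -sumrMnl rmorph_sum /=.
      rewrite exchange_big /=; apply: eq_bigr => j _.
      rewrite coef_col_Astar coef_Astar -rmorphM mulr_sumr rmorph_sum /=.
      by apply: eq_bigr => d _; rewrite -mulrnAl mulrC.
    by rewrite big1// => d _; rewrite Aw// mxE mul0rn.
  apply/colP => j; apply/eqP; rewrite mxE -(@intr_eq0 rat); exact/eqP/w0.
have [q [w [q0 qw]]] := common_denominator_cV (\col_j c j).
suff w0 : w = 0.
  move=> j; have /colP/(_ j) := qw; rewrite w0 !mxE => /eqP.
  by rewrite mulf_eq0 intr_eq0 (negbTE q0) => /eqP.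
apply: free => d; case: (unliftP ord0 d) => [d' -> _|-> //].
apply/colP => i; rewrite [RHS]mxE; apply/eqP; rewrite -(@intr_eq0 rat).
have /colP/(_ i)/(congr1 (fun p : {poly rat} => q%:~R * p`_d'.+1)) := sumc.
rewrite summxE mxE coef0 mulr0 coef_sum mulr_sumr => <-; apply/eqP.
rewrite mxE rmorph_sum; apply: eq_bigr => j _ /=.
rewrite coef_col_Astar coef_Astar_lift mulrA rmorphM mulrC; congr (_ * _).
by have /colP/(_ j) := qw; rewrite !mxE.
Qed.

Lemma dotv_condP :
  (forall (v : 'cV[rat]_L) (w : 'cV[rat]_N),
     (forall d : 'I_D.+1, (0 < d)%N -> dotv v (map_mx intr (A_ d) *m w) = 0) ->
     dotv v (map_mx intr (A_ ord0) *m w) = 0) <->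
  (forall (v : 'rV[int]_L) (w : 'cV[int]_N),
    (forall d : 'I_D.+1, (0 < d)%N -> v *m (A_ d *m w) = 0) -> v *m (A_ ord0 *m w) = 0).
Proof.
split=> [cond v w vw|cond v w vw].
  apply/matrixP => i j; rewrite !ord1 [RHS]mxE.
  have := cond (map_mx intr v^T) (map_mx intr w); rewrite dotv_int trmxK.
  move=> h; apply/eqP; rewrite -(@intr_eq0 rat); apply/eqP/h => d d0.
  by rewrite dotv_int trmxK vw// mxE.
have [q [v' [q0 Ev]]] := common_denominator_cV v.
have [p [w' [p0 Ew]]] := common_denominator_cV w.
(* Bilinearity clears the denominators of both vectors at once. *)
have E M : q%:~R * p%:~R * dotv v (map_mx intr M *m w) = ((v'^T *m (M *m w')) 0 0)%:~R.
  rewrite -dotv_int -Ev -Ew !dotvE linearZ -scalemxAl -!scalemxAr [RHS]mxE [X in _ = _ * X]mxE.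
  by rewrite mulrA.
apply/eqP; have /eqP := E (A_ ord0); rewrite cond; last first.
  move=> d d0; apply/matrixP => i j; rewrite !ord1 [RHS]mxE; apply/eqP.
  by rewrite -(@intr_eq0 rat) -E vw// mulr0.
by rewrite mxE !mulf_eq0 !intr_eq0 (negbTE q0) (negbTE p0).
Qed.

End Arithmetic.

Theorem theorem1p2 (R : realType) (L N D : nat)
    (A : 'M[{poly int}]_(L, N)) (A_ : 'I_D.+1 -> 'M[int]_(L, N))
    (hA : A = \sum_(d < D.+1) 'X^d *: map_mx polyC (A_ d)) :
  let Astar := A - map_mx polyC (A_ ord0) in
  (forall X : set (torus R N), infinite_set X ->
    exists2 T : set (torus R L), subtorus T &
      forall e : R, 0 < e ->
        exists n : int, exists a : torus R L,
          eps_dense e (torus_act (eval_mx A n) @` X) (translate a T))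
  <->
  (cols_Q_free (map_mx (map_poly intr) Astar) /\
   forall (v : 'cV[rat]_L) (w : 'cV[rat]_N),
     (forall d : 'I_D.+1, (0 < d)%N -> dotv v (map_mx intr (A_ d) *m w) = 0) ->
     dotv v (map_mx intr (A_ ord0) *m w) = 0).
Proof.
cbv zeta; rewrite hA; split=> [dense|[/cols_Q_freeP condA /dotv_condP condB] X Xinf].
  have [] : glasner_cond A_.
    apply: (@glasner_necessary R) => X /dense[T Tsub Tdense]; exists T => // e /Tdense.
    by under eq_exists do rewrite eval_mxE.
  by move=> condA condB; split; [exact/cols_Q_freeP|exact/dotv_condP].
have [T Tsub Tdense] := glasner_of_cond (conj condA condB) Xinf.
exists T => // e /Tdense[n [a dense]]; exists n, a.
by rewrite eval_mxE.
Qed.
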